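(* Let $J$ be an $R$-Hopf order in $(K[C_p^3])^*$, and let $$R\to H_{i_3}^*\to J\to H_{i_1,i_2,\mu}^*\to R$$ be a short exact sequence of $R$-Hopf algebras induced by $J$, where $i_1,i_2,i_3\ge 0$ are integers and $\mu\in K$ satisfies $\nu(\wp(\mu))\ge i_2-pi_1$ ($\mu$ representing a coset in $K/(\mathbb{F}_p+\mathfrak{p}^{i_2-i_1})$). Then there is a pair $(\alpha,\beta)\in K^2$, representing a coset in $$K^2/\bigl(\mathbb{F}_p(\mu,-1)+(\mathbb{F}_p+\mathfrak{p}^{i_3-i_1})\times\mathfrak{p}^{i_3-i_2}\bigr),$$ with $\nu(\wp(\alpha)+\wp(\mu)\beta)\ge i_3-pi_1$ and $\nu(\wp(\beta))\ge i_3-pi_2$, such that, as $R$-Hopf algebras, $$J\cong H^*_{i_1,i_2,i_3,\mu,\alpha,\beta} = R[\pi^{i_1}(\xi_{1,0,0}-\mu\xi_{0,1,0}-\alpha\xi_{0,0,1}),\ \pi^{i_2}(\xi_{0,1,0}-\beta\xi_{0,0,1}),\ \pi^{i_3}\xi_{0,0,1}].$$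
   Context: Let $p$ be a prime and let $K$ be a field of characteristic $p$ that is complete with respect to a discrete valuation $\nu:K\to\mathbb{Z}\cup\{\infty\}$ with uniformizing parameter $\pi$, $\nu(\pi)=1$. Let $R=\{x\in K\mid \nu(x)\ge 0\}$, and for $n\in\mathbb{Z}$ let $\mathfrak{p}^n=\{x\in K\mid\nu(x)\ge n\}$. For $x\in K$ put $\wp(x)=x^p-x$. For $\mu\in K$ put $\mathbb{F}_p(\mu,-1)=\{(m\mu,-m)\mid m\in\mathbb{F}_p\}\subseteq K^2$. For a finite dimensional $K$-Hopf algebra $B$, an $R$-Hopf order in $B$ is an $R$-Hopf algebra $H$ which is a finitely generated projective (hence free) $R$-submodule of $B$ with $K\otimes_R H\cong B$ as $K$-Hopf algebras; the comultiplication, counit and coinverse of $H$ are those induced from $B$. $C_p^3=\langle g_1,g_2,g_3\rangle$ is the elementary abelian group of order $p^3$, $(K[C_p^3])^*$ is the linear dual of the group ring, and $\langle -,-\rangle$ is the duality pairing. The elements $\xi_{1,0,0},\xi_{0,1,0},\xi_{0,0,1}\in (K[C_p^3])^*$ are defined by $\langle \xi_{1,0,0},(g_1-1)^j(g_2-1)^k(g_3-1)^l\rangle=\delta_{1,j}\delta_{0,k}\delta_{0,l}$, $\langle \xi_{0,1,0},(g_1-1)^j(g_2-1)^k(g_3-1)^l\rangle=\delta_{0,j}\delta_{1,k}\delta_{0,l}$, $\langle \xi_{0,0,1},(g_1-1)^j(g_2-1)^k(g_3-1)^l\rangle=\delta_{0,j}\delta_{0,k}\delta_{1,l}$ for $0\le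 j,k,l\le p-1$. They are primitive, each satisfies $\xi^p=\xi$, and they generate $(K[C_p^3])^*$ as a $K$-algebra. $H_{i_3}^*=R[\pi^{i_3}\xi_{0,0,1}]$ is a Hopf order in $(K[C_p])^*=K[\xi_{0,0,1}]$, and $H_{i_1,i_2,\mu}^*=R[\pi^{i_1}(\xi_{1,0,0}-\mu\xi_{0,1,0}),\pi^{i_2}\xi_{0,1,0}]$ is a Hopf order in $(K[C_p^2])^*=K[\xi_{1,0,0},\xi_{0,1,0}]$. Every $R$-Hopf order $J$ in $(K[C_p^3])^*$ induces a short exact sequence of $R$-Hopf algebras $R\to H\to J\to H'\to R$ with $H$ a Hopf order in $(K[C_p])^*$ and $H'$ a Hopf order in $(K[C_p^2])^*$, which after tensoring with $K$ becomes the exact sequence $K\to (K[C_p])^*\to (K[C_p^3])^*\to (K[C_p^2])^*\to K$ dual to $C_p^2\to C_p^3\to C_p$. By known classification results $H\cong H_{i_3}^*$ and $H'\cong H_{i_1,i_2,\mu}^*$ for some integers $i_1,i_2,i_3\ge0$ and some $\mu\in K$ with $\nu(\wp(\mu))\ge i_2-pi_1$. *)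

(* Defs.v *)
From HB Require Import structures.
From mathcomp Require Import all_boot all_order all_algebra all_fingroup.
From mathcomp Require Import boolp classical_sets functions constructive_ereal.
Set Implicit Arguments.
Unset Strict Implicit.
Unset Printing Implicit Defensive.
Import Order.TTheory GRing.Theory Num.Theory.
Local Open Scope classical_set_scope.
Local Open Scope ring_scope.

Section Valuation.
Variables (K : fieldType) (nu : K -> \bar int).

(* Z u {oo} is the type \bar int with -oo excluded. *)
Definition discrete_valuation : Prop :=
  [/\ forall x, nu x != -oo%E,
      forall x, nu x = +oo%E <-> x = 0,
      forall x y, nu (x * y) = (nu x + nu y)%E
    & forall x y, (Order.min (nu x) (nu y) <= nu (x + y))%E].

Definition valuation_complete : Prop :=
  forall u : nat -> K,
    (forall n : int, exists N : nat, forall i j : nat,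
       (N <= i)%N -> (N <= j)%N -> (n%:E <= nu (u i - u j))%E) ->
    exists l : K, forall n : int, exists N : nat, forall i : nat,
       (N <= i)%N -> (n%:E <= nu (u i - l))%E.

Definition fracideal (n : int) : set K := [set x | (n%:E <= nu x)%E].

Definition valring : set K := [set x | (0%:E <= nu x)%E].

End Valuation.

Definition wp (K : fieldType) (p : nat) (x : K) : K := x ^+ p - x.

Section GroupRing.
Variables (K : fieldType) (G : finGroupType).

Definition gring : Type := {ffun G -> K^o}.
HB.instance Definition _ := GRing.Lmodule.on gring.

Definition gelt (g : G) : gring := [ffun h => (h == g)%:R].

Definition gmul (u v : gring) : gring :=
  [ffun g => \sum_(h : G) u h * v (h^-1 * g)%g].

Lemma gmulA : associative gmul.
Proof.
move=> u v w; apply/ffunP=> g; rewrite !ffunE.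
under eq_bigr => h _ do rewrite ffunE big_distrr /=.
under [RHS]eq_bigr => h _ do rewrite ffunE big_distrl /=.
rewrite [RHS]exchange_big /=; apply: eq_bigr => h _.
rewrite [RHS](reindex_inj (mulgI h)) /=; apply: eq_bigr => k _.
by rewrite mulKg invMg -mulgA mulrA.
Qed.

Lemma gmul1g : left_id (gelt 1%g) gmul.
Proof.
move=> u; apply/ffunP=> g; rewrite !ffunE (bigD1 1%g) //= ffunE eqxx mul1r.
rewrite invg1 mul1g big1 ?addr0 // => h /negPf h1.
by rewrite ffunE h1 mul0r.
Qed.

Lemma gmulg1 : right_id (gelt 1%g) gmul.
Proof.
move=> u; apply/ffunP=> g; rewrite !ffunE (bigD1 g) //= ffunE mulVg eqxx mulr1.
rewrite big1 ?addr0 // => h hg.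
by rewrite ffunE -eq_mulVg1 (negPf hg) mulr0.
Qed.

Lemma gmulDl : left_distributive gmul +%R.
Proof.
move=> u v w; apply/ffunP=> g; rewrite !ffunE -big_split /=.
by apply: eq_bigr => h _; rewrite ffunE mulrDl.
Qed.

Lemma gmulDr : right_distributive gmul +%R.
Proof.
move=> u v w; apply/ffunP=> g; rewrite !ffunE -big_split /=.
by apply: eq_bigr => h _; rewrite ffunE mulrDr.
Qed.

HB.instance Definition _ := GRing.Zmodule_isPzRing.Build gring
  gmulA gmul1g gmulg1 gmulDl gmulDr.

End GroupRing.

(* A linear form on K[G] is given by its values on the basis G.  The library's
   pointwise product and unit on {ffun G -> K^o} are then the ones dual to the
   coproduct g |-> g (x) g and the counit g |-> 1 of K[G]. *)
Notation gdual K G := {ffun G -> K^o}.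

Section Dual.
Variables (K : fieldType) (G : finGroupType).
Implicit Types x y : gdual K G.

Definition pairing x (u : gring K G) : K := \sum_(g : G) x g * u g.

(* (K[G])^* (x) (K[G])^* is identified with (K[G x G])^*. *)
Definition tens x y : gdual K (G * G)%type := [ffun gh => x gh.1 * y gh.2].

Definition comul x : gdual K (G * G)%type := [ffun gh => x (gh.1 * gh.2)%g].

Definition counit x : K := x 1%g.

Definition antipode x : gdual K G := [ffun g => x g^-1%g].

Lemma comulP x (u v : gring K G) :
  pairing x (u * v) =
  \sum_(g : G) \sum_(h : G) comul x (g, h) * (u g * v h).
Proof.
rewrite /pairing; under eq_bigr => g _ do rewrite ffunE big_distrr /=.
rewrite exchange_big /=; apply: eq_bigr => h _.
rewrite (reindex_inj (mulgI h)) /=; apply: eq_bigr => k _.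
by rewrite ffunE /= mulKg.
Qed.

Lemma counitP x : counit x = pairing x 1.
Proof.
rewrite /pairing (bigD1 1%g) //= ffunE eqxx mulr1 big1 ?addr0 // => g g1.
by rewrite ffunE (negPf g1) mulr0.
Qed.

Lemma pairing_gelt x g : pairing x (gelt K g) = x g.
Proof.
rewrite /pairing (bigD1 g) //= ffunE eqxx mulr1 big1 ?addr0 // => h hg.
by rewrite ffunE (negPf hg) mulr0.
Qed.

End Dual.

Definition transpose (K : fieldType) (G G' : finGroupType) (f : G -> G')
  (x : gdual K G') : gdual K G := [ffun g => x (f g)].

(* In this section R is a subring of K, given as a set; R = setT gives
   K-algebras and K-Hopf algebras. *)
Section Orders.
Variables (K : fieldType) (R : set K).

Section Subalgebra.
Variable G : finGroupType.
Implicit Types J : set (gdual K G).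

Definition subalgebra J : Prop :=
  [/\ J 1, forall r x y, R r -> J x -> J y -> J (r *: x + y)
    & forall x y, J x -> J y -> J (x * y)].

Definition subalg_gen (s : seq (gdual K G)) : set (gdual K G) :=
  smallest subalgebra [set` s].

(* J has a finite R-basis that is also a K-basis of (K[G])^*: J is finitely
   generated and free over R, and K (x)_R J -> (K[G])^* is bijective. *)
Definition lattice J : Prop :=
  exists2 b : seq (gdual K G), basis_of fullv b &
    J = [set x | exists c : 'I_(size b) -> K,
           (forall i, R (c i)) /\ x = \sum_(i < size b) c i *: b`_i].

(* The image of J (x)_R J in the tensor square of (K[G])^*. *)
Definition tens_sq J : set (gdual K (G * G)%type) :=
  [set z | exists t : seq (gdual K G * gdual K G),
     (forall u, u \in t -> J u.1 /\ J u.2) /\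
     z = \sum_(u <- t) tens u.1 u.2].

Definition hopf_order J : Prop :=
  [/\ subalgebra J, lattice J,
      forall x, J x -> tens_sq J (comul x),
      forall x, J x -> R (counit x)
    & forall x, J x -> J (antipode x)].

End Subalgebra.

Section Morphisms.
Variables G G' : finGroupType.
Implicit Type J : set (gdual K G).

(* Only the values of f on J are relevant. Since J (x)_R J embeds in the tensor
   square of (K[G])^*, the last condition is (f (x) f) \o comul = comul \o f
   on J. *)
Definition hopf_hom J (J' : set (gdual K G')) (f : gdual K G -> gdual K G') : Prop :=
  (forall x, J x -> J' (f x)) /\
  [/\ forall r x y, R r -> J x -> J y -> f (r *: x + y) = r *: f x + f y,
      f 1 = 1 /\ (forall x y, J x -> J y -> f (x * y) = f x * f y),
      forall x, J x -> counit (f x) = counit x,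
      forall x, J x -> f (antipode x) = antipode (f x)
    & forall x (t : seq (gdual K G * gdual K G)),
        J x -> (forall u, u \in t -> J u.1 /\ J u.2) ->
        comul x = \sum_(u <- t) tens u.1 u.2 ->
        comul (f x) = \sum_(u <- t) tens (f u.1) (f u.2)].

Definition hopf_iso J (J' : set (gdual K G')) (f : gdual K G -> gdual K G') : Prop :=
  hopf_hom J J' f /\ set_bij J J' f.

Definition hopf_isomorphic J (J' : set (gdual K G')) : Prop := exists f, hopf_iso J J' f.

End Morphisms.

(* R -> H -> J -> H' -> R is exact: i is injective, q is surjective and
   ker q = J i(H^+), where H^+ is the augmentation ideal of H. *)
Definition short_exact (G' G G'' : finGroupType) (H : set (gdual K G'))
    (J : set (gdual K G)) (H' : set (gdual K G''))
    (i : gdual K G' -> gdual K G) (q : gdual K G -> gdual K G'') : Prop :=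
  [/\ hopf_hom H J i /\ hopf_hom J H' q, set_inj H i, set_surj J H' q
    & forall x, J x ->
        (q x = 0 <->
         exists t : seq (gdual K G * gdual K G'),
           (forall u, u \in t -> [/\ J u.1, H u.2 & counit u.2 = 0]) /\
           x = \sum_(u <- t) u.1 * i u.2)].

End Orders.

(* C_p^n, written additively. *)
Notation Cp p n := 'rV['F_p]_n.

Definition cgen (p n : nat) (j : 'I_n) : Cp p n := delta_mx 0 j.

(* C_p^2 = <g_1, g_2> -> C_p^3 and C_p^3 -> C_p = <g_3>. *)
Definition cincl (p : nat) (v : Cp p 2) : Cp p 3 :=
  row_mx v (0 : Cp p 1) : Cp p (2 + 1).

Definition cproj (p : nat) (w : Cp p 3) : Cp p 1 :=
  rsubmx (w : Cp p (2 + 1)).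

(* Up to K-Hopf automorphisms of the outer terms, (i, q) is the restriction of
   K -> (K[C_p])^* -> (K[C_p^3])^* -> (K[C_p^2])^* -> K to H and J, i.e. it
   becomes that sequence after tensoring with K. *)
Definition generic_fibre_dual (p : nat) (K : fieldType)
    (H : set (gdual K (Cp p 1))) (J : set (gdual K (Cp p 3)))
    (i : gdual K (Cp p 1) -> gdual K (Cp p 3))
    (q : gdual K (Cp p 3) -> gdual K (Cp p 2)) : Prop :=
  exists (a : gdual K (Cp p 1) -> gdual K (Cp p 1))
         (c : gdual K (Cp p 2) -> gdual K (Cp p 2)),
  [/\ hopf_iso [set: K] [set: _] [set: _] a,
      hopf_iso [set: K] [set: _] [set: _] c,
      forall x, H x -> i x = transpose (@cproj p) (a x)
    & forall x, J x -> q x = c (transpose (@cincl p) x)].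

Definition xi_spec (K : fieldType) (p n : nat) (i : 'I_n)
    : set (gdual K (Cp p n)) :=
  [set x | forall e : 'I_n -> nat, (forall j, (e j < p)%N) ->
     pairing x (\prod_(j < n) (gelt K (cgen p j) - 1) ^+ e j)
     = \prod_(j < n) (e j == (j == i) :> nat)%:R].

Arguments xi_spec K p {n} i _.

(* The element satisfying xi_spec; see xiP for existence and xi_uniq for
   uniqueness. For n = 3 and i = 0, 1, 2 these are xi_{1,0,0}, xi_{0,1,0} and
   xi_{0,0,1}. *)
Definition xi (K : fieldType) (p n : nat) (i : 'I_n) : gdual K (Cp p n) :=
  xget 0 (xi_spec K p i).

Section XiTheory.
Variables (K : fieldType) (p : nat).
Hypotheses (p_pr : prime p) (charK : p \in [pchar K]).
Implicit Types n : nat.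

Definition coordf n (i : 'I_n) : gdual K (Cp p n) :=
  [ffun v : Cp p n => (v 0 i : nat)%:R].

Lemma pairingD n (x : gdual K (Cp p n)) u v :
  pairing x (u + v) = pairing x u + pairing x v.
Proof.
by rewrite /pairing -big_split /=; apply: eq_bigr => g _; rewrite ffunE mulrDr.
Qed.

Lemma pairing0 n (x : gdual K (Cp p n)) : pairing x 0 = 0.
Proof. by rewrite /pairing big1 // => g _; rewrite ffunE mulr0. Qed.

Lemma pairingN n (x : gdual K (Cp p n)) u : pairing x (- u) = - pairing x u.
Proof. by apply/eqP; rewrite -addr_eq0 -pairingD addNr pairing0. Qed.

Lemma pairingMn n (x : gdual K (Cp p n)) u k :
  pairing x (u *+ k) = pairing x u *+ k.
Proof.
by elim: k => [|k IH]; rewrite ?mulr0n ?pairing0 // !mulrS pairingD IH.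
Qed.

Lemma pairing1M n u v : pairing (1 : gdual K (Cp p n)) (u * v)
  = pairing 1 u * pairing 1 v.
Proof.
rewrite comulP big_distrl /=; apply: eq_bigr => g _.
rewrite big_distrr /=; apply: eq_bigr => h _.
by rewrite !ffunE !mul1r.
Qed.

Lemma natr_Fp (a b : 'F_p) : ((a + b)%R : nat)%:R = a%:R + b%:R :> K.
Proof.
have -> : ((a + b)%R : nat) = (((a : nat) + b) %% p)%N.
  transitivity (((a : nat) + b) %% (Zp_trunc (pdiv p)).+2)%N => //.
  by congr (_ %% _)%N; exact: Fp_cast.
have /(congr1 (fun q => q%:R : K)) := divn_eq ((a : nat) + b)%N p.
by rewrite !natrD natrM (pcharf0 charK) mulr0 add0r => <-.
Qed.

Lemma pairing_coordM n (i : 'I_n) u v :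
  pairing (coordf i) (u * v) =
  pairing (coordf i) u * pairing 1 v + pairing 1 u * pairing (coordf i) v.
Proof.
rewrite comulP /pairing !big_distrl /= -big_split /=; apply: eq_bigr => g _.
rewrite !big_distrr -big_split /=; apply: eq_bigr => h _.
rewrite !ffunE /= mxE natr_Fp !mul1r mulrDl.
by congr (_ + _); [exact: mulrA | exact: mulrCA].
Qed.

Lemma pairing_gen n (x : gdual K (Cp p n)) j :
  pairing x (gelt K (cgen p j) - 1) = x (cgen p j) - x 0.
Proof. by rewrite pairingD pairingN pairing_gelt -counitP. Qed.

Lemma pairing1X n (j : 'I_n) e :
  pairing (1 : gdual K (Cp p n)) ((gelt K (cgen p j) - 1) ^+ e) = (e == 0)%:R.
Proof.
elim: e => [|e _]; first by rewrite expr0 -counitP /counit ffunE.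
by rewrite exprS pairing1M pairing_gen !ffunE subrr mul0r.
Qed.

Lemma coordX n (i j : 'I_n) e :
  pairing (coordf i) ((gelt K (cgen p j) - 1) ^+ e)
  = ((e == 1) && (j == i))%:R.
Proof.
case: e => [|[|e]]; first by rewrite expr0 -counitP /counit ffunE mxE.
  rewrite expr1 pairing_gen !ffunE !mxE !eqxx subr0 eq_sym /=.
  by case: (_ == _) => //=; rewrite modn_small // Fp_cast // prime_gt1.
rewrite exprS pairing_coordM pairing1X mulr0 add0r.
by rewrite pairing_gen !ffunE subrr mul0r.
Qed.

Lemma pairing1_prod n (s : seq 'I_n) (e : 'I_n -> nat) :
  pairing (1 : gdual K (Cp p n)) (\prod_(j <- s) (gelt K (cgen p j) - 1) ^+ e j)
  = \prod_(j <- s) (e j == 0)%:R.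
Proof.
elim: s => [|j s IH]; first by rewrite !big_nil -counitP /counit ffunE.
by rewrite !big_cons pairing1M IH pairing1X.
Qed.

Lemma coord_prod n (i : 'I_n) (s : seq 'I_n) (e : 'I_n -> nat) :
  uniq s ->
  pairing (coordf i) (\prod_(j <- s) (gelt K (cgen p j) - 1) ^+ e j)
  = (i \in s)%:R * \prod_(j <- s) (e j == (j == i) :> nat)%:R.
Proof.
elim: s => [_|j s IH /= /andP[js us]].
  by rewrite !big_nil -counitP /counit !ffunE mxE mul0r.
rewrite !big_cons pairing_coordM IH // pairing1_prod pairing1X coordX in_cons.
have [<-|ji] := eqVneq j i; last first.
  by rewrite andbF mul0r add0r /= mulrCA.
rewrite (negPf js) !mul0r mulr0 addr0 andbT mul1r.
congr (_ * _); apply: eq_big_seq => k ks.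
by case: (eqVneq k j) => // kj; rewrite -kj ks in js.
Qed.

Lemma coordf_spec n (i : 'I_n) : xi_spec K p i (coordf i).
Proof.
by move=> e _; rewrite coord_prod ?index_enum_uniq // mem_index_enum mul1r.
Qed.

Lemma geltM n (g h : Cp p n) : gelt K g * gelt K h = gelt K (g * h)%g.
Proof.
apply/ffunP=> k; rewrite !ffunE (bigD1 g) //= !ffunE eqxx mul1r.
rewrite big1 ?addr0 => [|l lg]; last by rewrite ffunE (negPf lg) mul0r.
by rewrite -(inj_eq (mulgI g)) mulKVg.
Qed.

Lemma gelt_prod n (v : Cp p n) :
  gelt K v = \prod_(j < n) gelt K (cgen p j) ^+ (v 0 j : nat).
Proof.
have gX (g : Cp p n) k : gelt K g ^+ k = gelt K (g *+ k).
  elim: k => [|k IH]; first by rewrite mulr0n.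
  by rewrite exprS IH geltM mulrS.
rewrite {1}(row_sum_delta v).
transitivity (\prod_(j < n) gelt K (v 0 j *: (delta_mx 0 j : Cp p n))%R).
  elim/big_rec2: _ => // j u w _ <-; exact: (esym (geltM _ _)).
apply: eq_bigr => j _; rewrite gX /cgen -scaler_nat natr_Zp.
exact: erefl.
Qed.

Lemma xi_uniq n (i : 'I_n) x y : xi_spec K p i x -> xi_spec K p i y -> x = y.
Proof.
move=> hx hy; apply/ffunP => v0.
have [v ->] : exists v : Cp p n, v0 = v by exists v0.
rewrite -(pairing_gelt x) -(pairing_gelt y) gelt_prod.
have E (j : 'I_n) : gelt K (cgen p j) ^+ (v 0%R j : nat) =
    \sum_(k < p) (gelt K (cgen p j) - 1) ^+ k *+ 'C(v 0%R j, k).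
  rewrite -{1}(subrK 1 (gelt K (cgen p j))) exprD1n.
  have vp : (v 0%R j < p)%N by rewrite (leq_trans (ltn_ord _)) // Fp_cast.
  rewrite (big_ord_widen _ (fun k => (gelt K (cgen p j) - 1) ^+ k *+ 'C(v 0%R j, k)) vp).
  rewrite big_mkcond /=; apply: eq_bigr => k _; case: ifPn => // kv.
  by rewrite bin_small ?mulr0n // ltnNge -ltnS.
rewrite (eq_bigr _ (fun j _ => E j)) bigA_distr_bigA /=.
elim/big_rec: _ => [|f u _ IH]; first by rewrite !pairing0.
rewrite !pairingD IH; congr (_ + _).
rewrite prodrMn !pairingMn; congr (_ *+ _).
by rewrite (hx (fun j => f j)) ?(hy (fun j => f j)).
Qed.

Lemma xiE n (i : 'I_n) : xi K p i = [ffun v : Cp p n => (v 0 i : nat)%:R].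
Proof.
apply: (@xi_uniq _ i); last exact: coordf_spec.
by apply: (@xgetI _ _ (xi_spec K p i) (coordf i)); exact: coordf_spec.
Qed.

Lemma xiP n (i : 'I_n) : xi_spec K p i (xi K p i).
Proof. rewrite xiE; exact: coordf_spec. Qed.

End XiTheory.

Section HopfOrdersCp3.
Variables (p : nat) (K : fieldType) (nu : K -> \bar int) (pi : K).

(* H_{i3}^*, where K[xi_{0,0,1}] is (K[C_p])^* for C_p = <g_3>. *)
Definition Hdual1 (i3 : nat) : set (gdual K (Cp p 1)) :=
  let x3 := xi K p (@Ordinal 1 0 isT) in
  subalg_gen (valring nu) [:: pi ^+ i3 *: x3].

Definition Hdual2 (i1 i2 : nat) (mu : K) : set (gdual K (Cp p 2)) :=
  let x1 := xi K p (@Ordinal 2 0 isT) in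
  let x2 := xi K p (@Ordinal 2 1 isT) in
  subalg_gen (valring nu) [:: pi ^+ i1 *: (x1 - mu *: x2); pi ^+ i2 *: x2].

Definition Hdual3 (i1 i2 i3 : nat) (mu alpha beta : K)
    : set (gdual K (Cp p 3)) :=
  let x1 := xi K p (@Ordinal 3 0 isT) in
  let x2 := xi K p (@Ordinal 3 1 isT) in
  let x3 := xi K p (@Ordinal 3 2 isT) in
  subalg_gen (valring nu)
    [:: pi ^+ i1 *: (x1 - mu *: x2 - alpha *: x3);
        pi ^+ i2 *: (x2 - beta *: x3);
        pi ^+ i3 *: x3].

(* F_p, as a subset of K. *)
Definition prime_subfield : set K := range (fun m : 'F_p => (m : nat)%:R).

(* F_p (mu, -1) + (F_p + m^{i3 - i1}) x m^{i3 - i2}, m the maximal ideal of R. *)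
Definition param_subgroup (i1 i2 i3 : nat) (mu : K) : set (K * K) :=
  [set u + v | u in [set (m * mu, - m) | m in prime_subfield]
             & v in [set x + y | x in prime_subfield
                               & y in fracideal nu (i3%:Z - i1%:Z)]
                    `*` fracideal nu (i3%:Z - i2%:Z)].

End HopfOrdersCp3.

Arguments Hdual1 p {K} nu pi i3 _.
Arguments Hdual2 p {K} nu pi i1 i2 mu _.
Arguments Hdual3 p {K} nu pi i1 i2 i3 mu alpha beta _.
Arguments param_subgroup p {K} nu i1 i2 i3 mu _.

Definition is_coset (V : zmodType) (L C : set V) : Prop :=
  exists v : V, C = [set v + l | l in L].

(* Main.v *)
Require Import Defs.
From HB Require Import structures.
From mathcomp Require Import all_boot all_order all_algebra all_fingroup.
From mathcomp Require Import boolp classical_sets functions constructive_ereal.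
From mathcomp Require Import zify ring.
Set Implicit Arguments.
Unset Strict Implicit.
Unset Printing Implicit Defensive.
Import Order.TTheory GRing.Theory Num.Theory.
Local Open Scope classical_set_scope.
Local Open Scope ring_scope.

(** The dual [J^D] of the Hopf order [J] is a lattice in the group ring of an
    elementary abelian [p]-group over a field of characteristic [p], so each
    element of its augmentation ideal has [p]-th power zero ([gring_frobenius]).
    This makes extensions by an order of rank [p] almost split, in the following
    sense.

    Let [t] be the generator of the image of [H_{i3}^*] in [J].  It is not
    divisible by [pi] in [J]: by exactness such a quotient would be [t * v] with
    [v] in [J], and elements of [J] have integral values ([order_value],
    [sub_gen_saturated]).  Hence some [z] in the augmentation ideal of [J^D] pairs
    to 1 with [t] ([dual_order_split]).  As [z ^+ p = 0], the algebra [J^D] is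
    freely generated by [z] over its part supported on the subgroup [C_p^2], and
    setting [z] to zero is an algebra retraction onto that part.  Primitive
    elements of an order are the derivations of its dual at the augmentation;
    composing with the retraction extends those of the quotient to [J].  So a
    primitive element over [K] that lifts a primitive element of the quotient and
    vanishes on [z] lies in [J] ([primitive_lift]).

    Applied to the two generators of [H_{i1,i2,mu}^*], this gives two primitive
    elements [x] and [y] of [J], and the parameters [alpha] and [beta] are the
    coefficients of [xi_{0,0,1}] in them.  The elements [x], [y], [t] are
    independent modulo [pi] in the cotangent space ([Hdual2_saturated],
    [generators_saturated]), so that they are part of a system dual to
    augmentation elements of [J^D].  The pairings between the monomials of a dual
    system form a triangular matrix with units on the diagonal
    ([pairing_monomial], [monomial_coefs]), so [x], [y], [t] generate [J]
    ([order_generated]).  The valuation conditions on [alpha] and [beta] say that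
    the [p]-th powers of [x] and [y], which lie in [J], have an integral
    coefficient on [t].

    The isomorphism from [J] to the model is induced by a linear automorphism of
    the group.  It is needed because the given sequence is the standard one only
    up to Hopf algebra automorphisms of its two ends over [K]; on primitive
    elements such an automorphism is given by a matrix over [F_p]
    ([hopf_automorphism_linear]). *)

(** * Duality between functions and the group ring *)

HB.instance Definition _ (aT : finType) (A : comPzRingType) :=
  GRing.PzRing_hasCommutativeMul.Build {ffun aT -> A} (@ffun_mulC aT A).

Lemma gring1_neq0 (K : fieldType) (G : finGroupType) : (1 : gring K G) != 0.
Proof. by apply/eqP => /ffunP/(_ 1%g)/eqP; rewrite !ffunE eqxx oner_eq0. Qed.

HB.instance Definition _ (K : fieldType) (G : finGroupType) :=
  GRing.PzSemiRing_isNonZero.Build (gring K G) (@gring1_neq0 K G).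

Lemma gmulC (K : fieldType) (p n : nat) : commutative (@gmul K (Cp p n)).
Proof.
move=> u v; apply/ffunP=> g; rewrite !ffunE.
rewrite (reindex_inj (inj_comp (mulgI g) invg_inj)) /=; apply: eq_bigr => h _.
rewrite mulrC; congr (v _ * u _).
  by rewrite invMg invgK -mulgA mulVg mulg1.
exact: (addrC g (- h)).
Qed.

HB.instance Definition _ (K : fieldType) (p n : nat) :=
  GRing.PzRing_hasCommutativeMul.Build (gring K (Cp p n)) (@gmulC K p n).

Section PairingCalculus.
Variables (K : fieldType) (G : finGroupType).
Implicit Types (f : gdual K G) (u v : gring K G).

Lemma pairingDr f u v : pairing f (u + v) = pairing f u + pairing f v.
Proof.
by rewrite /pairing -big_split /=; apply: eq_bigr => g _; rewrite ffunE mulrDr.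
Qed.

Lemma pairingZr f (c : K) u : pairing f (c *: u) = c * pairing f u.
Proof.
rewrite /pairing big_distrr /=; apply: eq_bigr => g _.
by rewrite ffunE mulrCA.
Qed.

Lemma pairingBr f u v : pairing f (u - v) = pairing f u - pairing f v.
Proof. by rewrite -scaleN1r pairingDr pairingZr mulN1r. Qed.

Lemma pairing0r f : pairing f (0 : gring K G) = 0.
Proof. by rewrite -(subrr 0) pairingBr subrr. Qed.

Lemma pairingDl f1 f2 u : pairing (f1 + f2) u = pairing f1 u + pairing f2 u.
Proof.
by rewrite /pairing -big_split /=; apply: eq_bigr => g _; rewrite ffunE mulrDl.
Qed.

Lemma pairingZl (c : K) f u : pairing (c *: f) u = c * pairing f u.
Proof.
rewrite /pairing big_distrr /=; apply: eq_bigr => g _.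
by rewrite ffunE mulrA.
Qed.

Lemma pairingBl f1 f2 u : pairing (f1 - f2) u = pairing f1 u - pairing f2 u.
Proof. by rewrite -scaleN1r pairingDl pairingZl mulN1r. Qed.

Lemma pairing0l u : pairing (0 : gdual K G) u = 0.
Proof. by rewrite -(subrr 0) pairingBl subrr. Qed.

Lemma pairing_suml (I : Type) (r : seq I) (P : pred I) (F : I -> gdual K G) u :
  pairing (\sum_(i <- r | P i) F i) u = \sum_(i <- r | P i) pairing (F i) u.
Proof.
apply: (big_morph (fun f => pairing f u)) => [f1 f2|]; last exact: pairing0l.
exact: pairingDl.
Qed.

Lemma pairingM f u v :
  pairing f (u * v) = \sum_g \sum_h f (g * h)%g * (u g * v h).
Proof.
rewrite comulP; apply: eq_bigr => g _; apply: eq_bigr => h _.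
by rewrite ffunE.
Qed.

Lemma gmulE u v g : (u * v) g = \sum_h u h * v (h^-1 * g)%g.
Proof. by rewrite ffunE. Qed.

Lemma gscaleAl (c : K) u v : c *: (u * v) = (c *: u) * v.
Proof.
apply/ffunP => g; rewrite ffunE !gmulE scaler_sumr; apply: eq_bigr => h _.
by rewrite ffunE -scalerAl.
Qed.

Lemma gscaleAr (c : K) u v : c *: (u * v) = u * (c *: v).
Proof.
apply/ffunP => g; rewrite ffunE !gmulE scaler_sumr; apply: eq_bigr => h _.
by rewrite ffunE -scalerAr.
Qed.

Lemma gelt_decomp u : u = \sum_g u g *: gelt K g.
Proof.
apply/ffunP => h; rewrite sum_ffunE (bigD1 h) //= ffunE ffunE eqxx.
rewrite big1 ?addr0; last first.
  by move=> g gh; rewrite !ffunE eq_sym (negPf gh) scaler0.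
by rewrite -[LHS]mulr1.
Qed.

Lemma dscaleAl (c : K) f1 f2 : c *: (f1 * f2) = (c *: f1) * f2.
Proof. by apply/ffunP => g; rewrite !ffunE scalerAl. Qed.

Lemma dscaleAr (c : K) f1 f2 : c *: (f1 * f2) = f1 * (c *: f2).
Proof. by apply/ffunP => g; rewrite !ffunE scalerAr. Qed.

Lemma dexpE f k g : (f ^+ k) g = (f g : K) ^+ k.
Proof. by elim: k => [|k IH]; rewrite ?ffunE // !exprS !ffunE IH. Qed.

Lemma pairing_counit_mul u v : pairing 1 (u * v) = pairing 1 u * pairing 1 v.
Proof.
rewrite pairingM /pairing big_distrl /=; apply: eq_bigr => g _.
rewrite big_distrr /=; apply: eq_bigr => h _.
by rewrite !ffunE !mul1r.
Qed.

(** [hmul f] is the transpose of multiplication by [f] in the dual, [transl u]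
    the transpose of multiplication by [u] in the group ring; the second is how
    an order is acted upon by its dual. *)
Definition hmul f u : gring K G := [ffun g => f g * u g].
Definition transl u f : gdual K G := [ffun g => pairing f (gelt K g * u)].

Lemma pairing_hmul f1 f2 u : pairing f1 (hmul f2 u) = pairing (f1 * f2) u.
Proof. by apply: eq_bigr => g _; rewrite !ffunE mulrA. Qed.

Lemma translE u f g : transl u f g = \sum_h f (g * h)%g * u h.
Proof.
rewrite ffunE pairingM (bigD1 g) //= [X in _ + X]big1 ?addr0 => [|k /negPf kg].
  by apply: eq_bigr => h _; rewrite ffunE eqxx mul1r.
by rewrite big1 // => h _; rewrite ffunE kg mul0r mulr0.
Qed.

Lemma pairing_transl u f v : pairing (transl u f) v = pairing f (v * u).
Proof.
rewrite {2}(gelt_decomp v) mulr_suml.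
rewrite (big_morph (pairing f) (pairingDr f) (pairing0r f)).
by apply: eq_bigr => g _; rewrite -gscaleAl pairingZr ffunE mulrC.
Qed.

Definition additive_fun f := forall g h, f (g * h)%g = f g + f h.

Lemma additive_fun1 f : additive_fun f -> f 1%g = 0.
Proof. by move=> fD; have /eqP := fD 1%g 1%g; rewrite mulg1 -subr_eq subrr => /eqP. Qed.

Lemma additive_funZD (c : K) f1 f2 :
  additive_fun f1 -> additive_fun f2 -> additive_fun (c *: f1 + f2).
Proof. by move=> h1 h2 g h; rewrite !ffunE h1 h2 scalerDr addrACA. Qed.

Lemma additive_funZ (c : K) f : additive_fun f -> additive_fun (c *: f).
Proof. by move=> h1 g h; rewrite !ffunE h1 scalerDr. Qed.

Lemma additive_funB f1 f2 :
  additive_fun f1 -> additive_fun f2 -> additive_fun (f1 - f2).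
Proof.
by move=> h1 h2; rewrite addrC -scaleN1r; exact: additive_funZD.
Qed.

(** Homomorphisms to the additive group are the primitive elements of the dual,
    so they transl on the group ring as derivations. *)
Lemma hmul_der f u v : additive_fun f ->
  hmul f (u * v) = hmul f u * v + u * hmul f v.
Proof.
move=> fD; apply/ffunP => g; rewrite ffunE [in RHS]ffunE !gmulE.
rewrite -big_split big_distrr /=; apply: eq_bigr => h _.
have -> : f g = f h + f (h^-1 * g)%g by rewrite -fD mulKVg.
by rewrite !ffunE mulrDl mulrA mulrCA.
Qed.

Lemma pairing_additiveM f u v : additive_fun f ->
  pairing f (u * v) = pairing f u * pairing 1 v + pairing 1 u * pairing f v.
Proof.
move=> fD; have e w : pairing f w = pairing 1 (hmul f w).
  by rewrite pairing_hmul mul1r.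
by rewrite e hmul_der // pairingDr !pairing_counit_mul -!e.
Qed.

Lemma hmul1 f : additive_fun f -> hmul f 1 = 0.
Proof.
move=> fD; apply/ffunP => g; rewrite !ffunE.
by case: eqP => [->|_]; rewrite ?mulr0 // additive_fun1 // mul0r.
Qed.

Lemma additive_kills_sq f z u : additive_fun f ->
  pairing 1 z = 0 -> pairing f z = 0 -> pairing f (z * u) = 0.
Proof. by move=> fD z0 fz0; rewrite pairing_additiveM // fz0 z0 !mul0r add0r. Qed.

(** This filtration takes the place of the powers of the augmentation ideal: it is
    the orthogonal of the filtration of functions by polynomial degree, so that
    [vanish_hmul] and [vanishM] hold and pairings with low degree vanish by
    definition. *)
Definition vanish (m : nat) u :=
  forall s : seq (gdual K G), (forall f, f \in s -> additive_fun f) ->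
    (size s < m)%N -> pairing (\prod_(f <- s) f) u = 0.

Lemma vanish0 u : vanish 0 u. Proof. by []. Qed.

Lemma vanish1 u : pairing 1 u = 0 -> vanish 1 u.
Proof. by move=> hu [|//] _ _; rewrite big_nil. Qed.

Lemma vanishD m u v : vanish m u -> vanish m v -> vanish m (u + v).
Proof. by move=> hu hv s sa ss; rewrite pairingDr hu ?hv ?addr0. Qed.

Lemma vanish_hmul m f u : additive_fun f -> vanish m.+1 u -> vanish m (hmul f u).
Proof.
move=> fD hu s sa ss; rewrite pairing_hmul mulrC.
have := hu (f :: s); rewrite big_cons; apply => //= f'.
by rewrite inE => /predU1P[->|/sa].
Qed.

Lemma vanishM m n u v : vanish m u -> vanish n v -> vanish (m + n)%N (u * v).
Proof.
move=> hu hv s; elim: s m n u v hu hv => [|f s IH] m n u v hu hv sa ss.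
  rewrite big_nil pairing_counit_mul; case: m hu ss => [|m] hu ss; last first.
    by have := hu [::]; rewrite big_nil => -> //; rewrite mul0r.
  by have := hv [::]; rewrite big_nil => -> //; rewrite mulr0.
have fD : additive_fun f by apply: sa; rewrite inE eqxx.
have sa' f' : f' \in s -> additive_fun f' by move=> h; apply: sa; rewrite inE h orbT.
rewrite big_cons mulrC -pairing_hmul hmul_der // pairingDr.
have E a b : vanish a u -> vanish b v -> (size s < a.-1 + b)%N ->
    pairing (\prod_(j <- s) j) (hmul f u * v) = 0.
  by case: a => [|a] ha hb ss'; [apply: (IH 0%N b)|apply: (IH a b)] => //;
    apply: vanish_hmul.
have E' a b : vanish a u -> vanish b v -> (size s < a + b.-1)%N ->
    pairing (\prod_(j <- s) j) (u * hmul f v) = 0.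
  by case: b => [|b] ha hb ss'; [apply: (IH a 0%N)|apply: (IH a b)] => //;
    apply: vanish_hmul.
rewrite (E m n) ?(E' m n) ?addr0 //.
  by case: (n) hv ss => [|n'] //=; rewrite ?addn0 ?addnS // => _ /ltnW.
by case: (m) hu ss => [|m'] //= _; rewrite !add0n => /ltnW.
Qed.

End PairingCalculus.

(** * Monomials in dual primitive elements *)

Section DualSystems.
Variables (K : fieldType) (p n : nat) (I : finType).
Variables (X : I -> gdual K (Cp p n)) (Z : I -> gring K (Cp p n)).

Definition dual_system :=
  [/\ forall i, additive_fun (X i), forall j, pairing 1 (Z j) = 0
    & forall i j, pairing (X i) (Z j) = (i == j)%:R].

Hypothesis XZ : dual_system.
Implicit Types s t : seq I.

Lemma vanish_monomial t : vanish (size t) (\prod_(j <- t) Z j).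
Proof.
have [_ Z0 _] := XZ; elim: t => [|j t IH]; first exact: vanish0.
rewrite big_cons -[size _]/(1 + size t)%N; apply: vanishM => //; exact: vanish1.
Qed.

(** The derivation [hmul (X i)] acts on monomials in the [Z j] as the partial
    derivative in the variable [Z i], up to terms of higher order. *)
Lemma hmul_monomial i t :
  vanish (size t) (hmul (X i) (\prod_(j <- t) Z j)
    - (count_mem i t)%:R *: \prod_(j <- rem i t) Z j).
Proof.
have [XD Z0 XZd] := XZ; elim: t => [|k t IH].
  by rewrite big_nil hmul1 // scale0r subrr; exact: vanish0.
set P := \prod_(j <- t) Z j in IH *; set Q := \prod_(j <- rem i t) Z j in IH.
have -> : hmul (X i) (\prod_(j <- k :: t) Z j)
    - (count_mem i (k :: t))%:R *: \prod_(j <- rem i (k :: t)) Z j =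
  (hmul (X i) (Z k) - (i == k)%:R *: (1 : gring K (Cp p n))) * P
  + Z k * (hmul (X i) P - (count_mem i t)%:R *: Q).
  rewrite big_cons hmul_der // mulrBl mulrBr -gscaleAl mul1r -gscaleAr.
  rewrite addrACA -opprD; congr (_ - _).
  rewrite /= [k == i]eq_sym natrD scalerDl; case: (eqVneq i k) => [ik|ki].
    rewrite !scale1r; congr (_ + _); have [it|it] := boolP (i \in t); last first.
      by rewrite (count_memPn it) !scale0r.
    by rewrite (big_rem i it) /= -/Q ik.
  by rewrite !scale0r !add0r big_cons.
rewrite -[size (k :: t)]/(1 + size t)%N; apply: vanishD.
  apply: vanishM; last exact: vanish_monomial.
  apply: vanish1; rewrite pairingBr pairing_hmul mul1r XZd pairingZr.
  by rewrite -counitP /counit ffunE mulr1 subrr.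
by apply: vanishM => //; exact: vanish1.
Qed.

Fixpoint mult_fact s : nat :=
  if s is i :: s' then ((count_mem i s').+1 * mult_fact s')%N else 1%N.

(** Each primitive factor must differentiate away one factor [Z j], so the
    pairing counts the bijections that match the two lists of indices. *)
Lemma pairing_monomial s t : size s = size t ->
  pairing (\prod_(i <- s) X i) (\prod_(j <- t) Z j) =
  if perm_eq s t then (mult_fact s)%:R else 0.
Proof.
have [XD Z0 XZd] := XZ; elim: s t => [|i s IH] [|k t] //.
  by rewrite !big_nil perm_refl -counitP /counit ffunE.
case=> sst.
have st : size (k :: t) = (size t).+1 by [].
move: {t}(k :: t) (size t) st sst => t m st sst.
rewrite big_cons mulrC -pairing_hmul.
set u := hmul _ _; set v := (count_mem i t)%:R *: \prod_(j <- rem i t) Z j.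
have -> : pairing (\prod_(i <- s) X i) u = pairing (\prod_(i <- s) X i) v.
  apply/eqP; rewrite -subr_eq0 -pairingBr; apply/eqP.
  have := @hmul_monomial i t (map X s); rewrite big_map; apply.
    by move=> f /mapP[j _ ->].
  by rewrite size_map st sst.
rewrite pairingZr; have [it|it] := boolP (i \in t); last first.
  rewrite (count_memPn it) mul0r; case: ifP => // /perm_mem/(_ i).
  by rewrite inE eqxx (negPf it).
have perm_it := perm_to_rem it.
rewrite IH; last by rewrite size_rem // st /= sst.
have -> : perm_eq (i :: s) t = perm_eq s (rem i t).
  by rewrite (permPr perm_it) perm_cons.
case: ifP => [st'|_]; last by rewrite mulr0.
rewrite /= natrM; congr (_%:R * _).
by rewrite (seq.permP perm_it) /= eqxx (seq.permP st').
Qed.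

Lemma pairing_monomial_lt s t : (size s < size t)%N ->
  pairing (\prod_(i <- s) X i) (\prod_(j <- t) Z j) = 0.
Proof.
have [XD _ _] := XZ => st.
have := @vanish_monomial t (map X s); rewrite big_map size_map; apply=> //.
by move=> f /mapP[j _ ->].
Qed.

Hypotheses (p_pr : prime p) (charK : p \in [pchar K]).

Lemma natf_coprime_neq0 k : ~~ (p %| k)%N -> k%:R != 0 :> K.
Proof. by rewrite (dvdn_pcharf charK). Qed.

Lemma mult_fact_neq0 s : (forall i, (count_mem i s < p)%N) ->
  ~~ (p %| mult_fact s)%N.
Proof.
elim: s => [|i s IH] cs /=; first by rewrite Euclid_dvd1.
rewrite Euclid_dvdM // negb_or IH ?andbT.
  by rewrite gtnNdvd //; have := cs i; rewrite /= eqxx.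
by move=> j; apply: leq_ltn_trans (cs j); rewrite leq_addl.
Qed.

Definition exponents := {ffun I -> 'I_p}.
Definition expo_seq (b : exponents) : seq I :=
  flatten [seq nseq (b i) i | i <- enum I].
Definition xmono b : gdual K (Cp p n) := \prod_(i <- expo_seq b) X i.
Definition zmono b : gring K (Cp p n) := \prod_(i <- expo_seq b) Z i.

Lemma count_expo_seq b j : count_mem j (expo_seq b) = b j.
Proof.
rewrite count_flatten -map_comp sumnE big_map big_enum /= (bigD1 j) //=.
rewrite count_nseq /= eqxx mul1n big1 ?addn0 // => i /negPf ij.
by rewrite count_nseq /= ij.
Qed.

Lemma expo_seq_perm a b : perm_eq (expo_seq a) (expo_seq b) = (a == b).
Proof.
apply/idP/eqP => [/seq.permP h|->]; last exact: perm_refl.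
by apply/ffunP => j; apply/val_inj; rewrite /= -!count_expo_seq.
Qed.

(** Coefficients can be read off from pairings: the Gram matrix of the
    monomials is triangular for the total degree, with units on the diagonal.
    The set [S] stands for the valuation ring, where this shows that a form is
    an integral combination of monomials, or for zero, where it shows that the
    monomials are independent. *)
Lemma monomial_coefs (S : K -> Prop) (c : exponents -> K) :
  S 0 -> (forall x y, S x -> S y -> S (x - y)) ->
  (forall x k, ~~ (p %| k)%N -> S (x * k%:R) -> S x) ->
  (forall x a b, S x -> S (x * pairing (xmono b) (zmono a))) ->
  (forall a, S (pairing (\sum_b c b *: xmono b) (zmono a))) ->
  forall b, S (c b).
Proof.
move=> S0 SB SV SM Sc.
pose N := (\max_(b : exponents) size (expo_seq b))%N.
have sN b : (size (expo_seq b) <= N)%N by apply: (leq_bigmax b).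
suff H k b : (N < size (expo_seq b) + k)%N -> S (c b).
  by move=> b; apply: (H N.+1); rewrite addnS ltnS leq_addl.
elim: k b => [|k IH] a; first by rewrite addn0 ltnNge sN.
move=> ha; apply: (SV _ (mult_fact (expo_seq a))).
  apply: mult_fact_neq0 => i; by rewrite count_expo_seq ltn_ord.
have := Sc a; rewrite pairing_suml (bigD1 a) //= pairingZl.
rewrite pairing_monomial // perm_refl => h.
rewrite -(addrK (\sum_(b | b != a) pairing (c b *: xmono b) (zmono a)) (_ * _)).
apply: (SB _ _ h); elim/big_rec: _ => // b x ba Sx.
rewrite addrC -[pairing _ _]opprK; apply: (SB _ _ Sx).
rewrite -[- _]add0r; apply: (SB _ _ S0).
rewrite pairingZl; case: (ltngtP (size (expo_seq b)) (size (expo_seq a))) => hs.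
- by rewrite pairing_monomial_lt // mulr0.
- apply: SM; apply: IH; apply: leq_trans ha _.
  by rewrite addnS -addSn leq_add2r.
- by rewrite pairing_monomial // expo_seq_perm (negPf ba) mulr0.
Qed.

Hypothesis cardI : #|I| = n.

(** The [p ^ n] reduced monomials are independent, in a space of the same
    dimension. *)
Lemma monomial_span f : exists c : exponents -> K, f = \sum_b c b *: xmono b.
Proof.
pose F (c : {ffun exponents -> K^o}) : gdual K (Cp p n) :=
  \sum_b c b *: xmono b.
have Flin : linear F.
  move=> a c d; rewrite /F scaler_sumr -big_split /=; apply: eq_bigr => b _.
  by rewrite !ffunE scalerDl scalerA.
pose FL := GRing.isLinear.Build _ _ _ _ F Flin.
pose FF : {linear {ffun exponents -> K^o} -> gdual K (Cp p n)} := HB.pack F FL.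
pose L := linfun FF.
have LE c : L c = F c by rewrite lfunE.
have kerL : lker L == 0%VS.
  apply/lker0P => c d; rewrite !LE => cd; apply/ffunP => b.
  apply/eqP; rewrite -subr_eq0; apply/eqP.
  apply: (@monomial_coefs (fun x => x = 0) (fun b => c b - d b)) => //.
  - by move=> x y -> ->; rewrite subrr.
  - move=> x k /natf_coprime_neq0 k0 /eqP.
    by rewrite mulf_eq0 (negPf k0) orbF => /eqP.
  - by move=> x a b' ->; rewrite mul0r.
  - move=> a; have <- : F c - F d = \sum_b (c b - d b) *: xmono b.
      by rewrite -sumrB; apply: eq_bigr => b' _; rewrite scalerBl.
    by rewrite cd subrr pairing0l.
have dimE : dim {ffun exponents -> K^o} = dim (gdual K (Cp p n)).
  suff: \dim {: {ffun exponents -> K^o}} = \dim {: gdual K (Cp p n)}.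
    by rewrite !dimvf.
  rewrite !dimvf /dim /= !muln1 card_ffun card_ord cardI card_mx mul1n.
  by rewrite card_ord Fp_cast.
have /eqP imgL : (limg L == fullv)%VS.
  rewrite eqEdim subvf limg_dim_eq; last by rewrite (eqP kerL) capv0.
  by rewrite !dimvf dimE /=.
have : f \in limg L by rewrite imgL memvf.
by case/memv_imgP => c _ ->; exists c; rewrite LE.
Qed.

Lemma monomials_separate f : (forall a, pairing f (zmono a) = 0) -> f = 0.
Proof.
have [c ->] := monomial_span f => h; rewrite big1 // => b _.
suff -> : c b = 0 by rewrite scale0r.
apply: (@monomial_coefs (fun x => x = 0)) => //.
- by move=> x y -> ->; rewrite subrr.
- move=> x k /natf_coprime_neq0 k0 /eqP.
  by rewrite mulf_eq0 (negPf k0) orbF => /eqP.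
- by move=> x a b' ->; rewrite mul0r.
Qed.

End DualSystems.

(** * Frobenius on the group ring, and the valuation ring *)

Section Frobenius.
Variables (K : fieldType) (p n : nat).
Hypotheses (p_pr : prime p) (charK : p \in [pchar K]).
Implicit Types u : gring K (Cp p n).

Lemma gring_pchar : p \in [pchar (gring K (Cp p n))].
Proof.
rewrite inE p_pr; apply/eqP.
transitivity (p%:R *: (1 : gring K (Cp p n))); first by rewrite scaler_nat.
by rewrite (pcharf0 charK) scale0r.
Qed.

Lemma geltX (g : Cp p n) k : gelt K g ^+ k = gelt K (g *+ k).
Proof.
elim: k => [|k IH]; first by rewrite expr0 mulr0n.
by rewrite exprS IH geltM mulrS.
Qed.

Lemma gscaleX (c : K) u k : (c *: u) ^+ k = c ^+ k *: u ^+ k.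
Proof.
elim: k => [|k IH]; first by rewrite !expr0 scale1r.
by rewrite !exprS IH -gscaleAl -gscaleAr scalerA.
Qed.

(** The group is elementary abelian, so Frobenius factors through the
    augmentation; in particular augmentation ideals consist of [p]-nilpotents. *)
Lemma gring_frobenius u : u ^+ p = (pairing 1 u) ^+ p *: (1 : gring K (Cp p n)).
Proof.
have VpE (g : Cp p n) : g *+ p = 0.
  apply/rowP => j; rewrite mulmxnE mxE -mulr_natr.
  by rewrite (pcharf0 (pchar_Fp p_pr)) mulr0.
rewrite {1}(gelt_decomp u) -(pFrobenius_autE gring_pchar) rmorph_sum /=.
transitivity (\sum_g (u g) ^+ p *: (1 : gring K (Cp p n))).
  by apply: eq_bigr => g _; rewrite pFrobenius_autE gscaleX geltX VpE.
rewrite -scaler_suml /pairing; congr (_ *: _).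
under [X in X ^+ p]eq_bigr do rewrite ffunE mul1r.
by rewrite -(pFrobenius_autE charK) rmorph_sum.
Qed.
End Frobenius.

Section Valuation.
Variables (K : fieldType) (nu : K -> \bar int) (pi : K).
Hypotheses (nu_val : discrete_valuation nu) (nu_pi : nu pi = 1%:E).
Notation R := (valring nu).

Lemma nu_fin x : x != 0 -> exists m : int, nu x = m%:E.
Proof.
have [nuNy nuy _ _] := nu_val => x0; case E: (nu x) => [m||]; first by exists m.
  by move/nuy: E => E; rewrite E eqxx in x0.
by have := nuNy x; rewrite E eqxx.
Qed.

Lemma nuM x y : nu (x * y) = (nu x + nu y)%E.
Proof. by have [_ _ ->] := nu_val. Qed.

Lemma nu0 : nu 0 = +oo%E.
Proof. by have [_ h _ _] := nu_val; apply/h. Qed.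

Lemma nu1 : nu 1 = 0%:E.
Proof.
have [m E] := nu_fin (oner_neq0 K).
have := nuM 1 1; rewrite mulr1 E -EFinD => -[] /eqP.
by rewrite -[X in X == _]addr0 (inj_eq (addrI m)) eq_sym => /eqP ->.
Qed.

Lemma nuX x k (m : int) : nu x = m%:E -> nu (x ^+ k) = (m *+ k)%:E.
Proof.
move=> E; elim: k => [|k IH]; first by rewrite expr0 nu1 mulr0n.
by rewrite exprS nuM E IH mulrS EFinD.
Qed.

Lemma nuV x (m : int) : nu x = m%:E -> nu x^-1 = (- m)%:E.
Proof.
move=> E; have x0 : x != 0 by apply/eqP => x0; move: E; rewrite x0 nu0.
have xV0 : x^-1 != 0 by rewrite invr_eq0.
have [m' E'] := nu_fin xV0.
have := nuM x x^-1; rewrite divff // nu1 E E' -EFinD => -[] /eqP.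
by rewrite eq_sym addrC addr_eq0 => /eqP ->.
Qed.

Lemma pi_neq0 : pi != 0.
Proof. by apply/eqP => pi0; move: nu_pi; rewrite pi0 nu0. Qed.

Lemma nu_piX k : nu (pi ^+ k) = k%:Z%:E.
Proof. by rewrite (nuX _ nu_pi) natz. Qed.

Lemma nu_piXV k : nu (pi ^+ k)^-1 = (- k%:Z)%:E.
Proof. exact/nuV/nu_piX. Qed.

Lemma valringM x y : R x -> R y -> R (x * y).
Proof. by move=> hx hy; rewrite /valring /= nuM; exact: adde_ge0. Qed.

Lemma valringD x y : R x -> R y -> R (x + y).
Proof.
move=> hx hy; have [_ _ _ h] := nu_val.
by apply: le_trans (h x y); rewrite le_min; apply/andP.
Qed.

Lemma valring0 : R 0. Proof. by rewrite /valring /= nu0. Qed.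
Lemma valring1 : R 1. Proof. by rewrite /valring /= nu1. Qed.

Lemma valringN1 : R (-1).
Proof.
have N1 : (-1 : K) != 0 by rewrite oppr_eq0 oner_neq0.
have [m E] := nu_fin N1.
have := nuM (-1) (-1); rewrite mulrNN mulr1 nu1 E -EFinD => -[] m0.
by rewrite /valring /= E lee_fin; lia.
Qed.

Lemma valringN x : R x -> R (- x).
Proof. by move=> hx; rewrite -mulN1r; apply: valringM => //; exact: valringN1. Qed.

Lemma valringB x y : R x -> R y -> R (x - y).
Proof. by move=> hx hy; apply: valringD => //; exact: valringN. Qed.

Lemma valring_nat k : R k%:R.
Proof.
elim: k => [|k IH]; first exact: valring0.
by rewrite -addn1 natrD; apply: valringD => //; exact: valring1.
Qed.

Lemma valringX x k : R x -> R (x ^+ k).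
Proof.
move=> hx; elim: k => [|k IH]; first by rewrite expr0; exact: valring1.
by rewrite exprS; exact: valringM.
Qed.

Lemma valring_pi k : R (pi ^+ k).
Proof. by rewrite /valring /= nu_piX lee_fin. Qed.

Lemma valring_sum (I : Type) (r : seq I) (P : pred I) (F : I -> K) :
  (forall i, P i -> R (F i)) -> R (\sum_(i <- r | P i) F i).
Proof.
by move=> h; apply: (big_ind R) => //; [exact: valring0|exact: valringD].
Qed.

Lemma valring_piVN : ~ R pi^-1.
Proof. by rewrite /valring /= (nuV nu_pi) lee_fin. Qed.

Lemma valring_unit x : R x -> ~ R (pi^-1 * x) -> R x^-1.
Proof.
have [->|x0] := eqVneq x 0; first by rewrite invr0.
rewrite /valring /= nuM (nuV nu_pi); have [m E] := nu_fin x0.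
rewrite (nuV E) E -EFinD !lee_fin; lia.
Qed.

Lemma valring_shift j k x :
  R (pi ^+ j / pi ^+ k * x) <-> ((k%:Z - j%:Z)%:E <= nu x)%E.
Proof.
have [->|x0] := eqVneq x 0.
  by rewrite mulr0 nu0 leey; split => // _; exact: valring0.
have [m E] := nu_fin x0.
rewrite /valring /= !nuM E nu_piXV nu_piX -!EFinD !lee_fin; split; lia.
Qed.

Lemma valring_bound (s : seq K) : exists N, forall x, x \in s -> R (pi ^+ N * x).
Proof.
elim: s => [|x s [N IH]]; first by exists 0%N.
have [M hM] : exists M, R (pi ^+ M * x).
  have [->|x0] := eqVneq x 0; first by exists 0%N; rewrite mulr0; exact: valring0.
  have [m E] := nu_fin x0; exists `|m|%N.
  rewrite /valring /= nuM E nu_piX -EFinD lee_fin; lia.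
exists (N + M)%N => y; rewrite inE exprD => /predU1P[->|/IH hy].
  by rewrite -mulrA; apply: valringM => //; exact: valring_pi.
by rewrite mulrAC mulrC; apply: valringM => //; exact: valring_pi.
Qed.

(** The form of integrality that suits elements of finite subalgebras, whose
    powers have bounded denominators. *)
Lemma valring_power_bounded x N : (forall k, R (pi ^+ N * x ^+ k)) -> R x.
Proof.
have [->|x0] := eqVneq x 0; first by move=> _; exact: valring0.
have [m E] := nu_fin x0 => /(_ N.+1).
rewrite /valring /= nuM nu_piX (nuX _ E) -EFinD E !lee_fin mulrS -mulr_natr.
rewrite natz; nia.
Qed.

End Valuation.

(** * Hopf orders and their dual orders *)

Section HopfOrders.
Variables (K : fieldType) (nu : K -> \bar int) (pi : K).
Hypotheses (nu_val : discrete_valuation nu) (nu_pi : nu pi = 1%:E).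
Notation R := (valring nu).
Variables (G : finGroupType) (J : set (gdual K G)).
Hypothesis J_order : hopf_order R J.
Implicit Types (f : gdual K G) (u : gring K G).

Lemma order_one : J 1. Proof. by case: J_order => -[]. Qed.

Lemma orderM f1 f2 : J f1 -> J f2 -> J (f1 * f2).
Proof. by case: J_order => -[_ _ h] _ _ _ _; exact: h. Qed.

Lemma orderZD c f1 f2 : R c -> J f1 -> J f2 -> J (c *: f1 + f2).
Proof. by case: J_order => -[_ h _] _ _ _ _; exact: h. Qed.

Lemma orderD f1 f2 : J f1 -> J f2 -> J (f1 + f2).
Proof. by rewrite -{2}[f1]scale1r; apply: orderZD; exact: valring1. Qed.

Lemma order0 : J 0.
Proof.
rewrite -(addNr 1) -scaleN1r; apply: orderZD; [|exact: order_one..].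
exact: valringN1.
Qed.

Lemma orderZ c f : R c -> J f -> J (c *: f).
Proof. by move=> hc hf; rewrite -[_ *: _]addr0; apply: orderZD => //; exact: order0. Qed.

Lemma orderB f1 f2 : J f1 -> J f2 -> J (f1 - f2).
Proof.
by move=> h1 h2; rewrite addrC -scaleN1r; apply: orderZD => //; exact: valringN1.
Qed.

Lemma orderX f k : J f -> J (f ^+ k).
Proof.
move=> hf; elim: k => [|k IH]; first by rewrite expr0; exact: order_one.
by rewrite exprS; exact: orderM.
Qed.

Lemma order_sum (I : eqType) (r : seq I) (F : I -> gdual K G) :
  (forall i, i \in r -> J (F i)) -> J (\sum_(i <- r) F i).
Proof.
by move=> h; rewrite big_seq; apply: big_ind => //; [exact: order0|exact: orderD].
Qed.

Lemma order_prod (I : Type) (r : seq I) (F : I -> gdual K G) :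
  (forall i, J (F i)) -> J (\prod_(i <- r) F i).
Proof.
by move=> h; apply: big_ind => //; [exact: order_one|exact: orderM].
Qed.

(** Elements of a finite subalgebra are integral, so characters map them to the
    integrally closed ring [R]. *)
Lemma order_integral (chi : gdual K G -> K) f :
  (forall c f1 f2, chi (c *: f1 + f2) = c * chi f1 + chi f2) ->
  chi 1 = 1 -> (forall f1 f2, chi (f1 * f2) = chi f1 * chi f2) ->
  J f -> R (chi f).
Proof.
move=> chiZD chi1 chiM Jf.
have chi0 : chi 0 = 0 by rewrite -(addNr 1) -scaleN1r chiZD mulN1r chi1 addNr.
have chiX k : chi (f ^+ k) = chi f ^+ k.
  by elim: k => [|k IH] //; rewrite !exprS chiM IH.
case: J_order => _ [b _ Jb] _ _ _.
have [N hN] := valring_bound nu_val nu_pi (map chi b).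
apply: (valring_power_bounded nu_val nu_pi (N := N)) => k; rewrite -chiX.
have : J (f ^+ k) by exact: orderX.
rewrite Jb => -[c [Rc ->]].
have -> : chi (\sum_(i < size b) c i *: b`_i) = \sum_(i < size b) c i * chi b`_i.
  by elim/big_rec2: _ => // i x y _ <-; rewrite chiZD.
rewrite mulr_sumr; apply: valring_sum => // i _.
rewrite mulrCA; apply: valringM => //; apply: hN.
by apply: map_f; rewrite mem_nth.
Qed.

Lemma order_value f g : J f -> R (f g).
Proof.
apply: (order_integral (chi := fun f => f g)) => [c f1 f2||f1 f2];
  by rewrite !ffunE.
Qed.

Definition dual_order u := forall f, J f -> R (pairing f u).

Lemma dual_orderZ c u : R c -> dual_order u -> dual_order (c *: u).
Proof. by move=> hc hu f Jf; rewrite pairingZr; apply: valringM => //; exact: hu. Qed.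

Lemma dual_orderB u v : dual_order u -> dual_order v -> dual_order (u - v).
Proof.
by move=> hu hv f Jf; rewrite pairingBr; apply: valringB => //; [exact: hu|exact: hv].
Qed.

Lemma dual_order1 : dual_order 1.
Proof. by move=> f Jf; rewrite -counitP; exact: order_value. Qed.

(** If [comul f] is the sum of the [tens f1 f2], then [transl u f] is the sum of
    the [pairing f2 u *: f1]. *)
Lemma order_transl u f : dual_order u -> J f -> J (transl u f).
Proof.
move=> hu Jf; case: J_order => _ _ h _ _; have [t [Jt E]] := h _ Jf.
have -> : transl u f = \sum_(w <- t) pairing w.2 u *: w.1.
  apply/ffunP => g; rewrite translE sum_ffunE.
  transitivity (\sum_h \sum_(w <- t) w.1 g * w.2 h * u h).
    apply: eq_bigr => h' _; rewrite -mulr_suml; congr (_ * _).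
    have := congr1 (fun F : gdual K _ => F (g, h')) E; rewrite ffunE /= => ->.
    by rewrite sum_ffunE; apply: eq_bigr => w _; rewrite ffunE.
  rewrite exchange_big /=; apply: eq_bigr => w _.
  rewrite ffunE; transitivity (w.1 g * pairing w.2 u); last exact: mulrC.
  rewrite big_distrr /=; apply: eq_bigr => h' _.
  by rewrite mulrA.
by apply: order_sum => w /Jt[J1 J2]; apply: orderZ => //; exact: hu.
Qed.

Lemma dual_orderM u v : dual_order u -> dual_order v -> dual_order (u * v).
Proof. by move=> hu hv f Jf; rewrite -pairing_transl; apply: hu; exact: order_transl. Qed.

Lemma dual_orderX u k : dual_order u -> dual_order (u ^+ k).
Proof.
move=> hu; elim: k => [|k IH]; first by rewrite expr0; exact: dual_order1.
by rewrite exprS; exact: dual_orderM.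
Qed.

Lemma dual_order_hmul f u : J f -> dual_order u -> dual_order (hmul f u).
Proof. by move=> Jf hu f' Jf'; rewrite pairing_hmul; apply: hu; exact: orderM. Qed.

(** An element of the augmentation ideal of [J] that is not divisible by a
    non-unit of [R] is part of an [R]-basis, hence split off by a form in the
    augmentation ideal of the dual order. *)
Lemma dual_order_split f : J f -> counit f = 0 ->
  (forall c, J (c *: f) -> R c) ->
  exists u, [/\ dual_order u, pairing 1 u = 0 & pairing f u = 1].
Proof.
move=> Jf f1 fR; case: J_order => _ [b b_basis Jb] _ _ _.
have := Jf; rewrite Jb => -[c [Rc fE]].
(* Otherwise [pi^-1 *: f] would lie in [J]. *)
have [i ci] : exists i, ~ R (pi^-1 * c i).
  apply: contrapT => h; apply: (valring_piVN nu_val nu_pi); apply: fR.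
  rewrite Jb; exists (fun i => pi^-1 * c i); split.
    by move=> i; apply: contrapT => hi; apply: h; exists i.
  by rewrite fE scaler_sumr; apply: eq_bigr => i _; rewrite scalerA.
have ciV := valring_unit nu_val nu_pi (Rc i) ci.
have ci0 : c i != 0.
  by apply: contra_notN ci => /eqP ->; rewrite mulr0; exact: valring0.
pose bt := in_tuple b.
have b_free : free bt by exact: basis_free b_basis.
pose v : gring K G := [ffun g => coord bt i ([ffun h => (h == g)%:R] : gdual K G)].
have vE f' : pairing f' v = coord bt i f'.
  rewrite {2}(_ : f' = \sum_g f' g *: ([ffun h => (h == g)%:R] : gdual K G)).
    by rewrite linear_sum; apply: eq_bigr => g _; rewrite linearZ ffunE.
  exact: (gelt_decomp f').
have vJ : dual_order v.
  move=> f'; rewrite Jb => -[d [Rd ->]]; rewrite vE.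
  by rewrite (coord_sum_free (X := bt)).
have vf : pairing f v = c i by rewrite vE fE (coord_sum_free (X := bt)).
(* This normalization replaces [f'] by [f' - counit f' *: 1] in the pairing. *)
pose w := v - pairing 1 v *: (1 : gring K G).
have E1 : pairing 1 (1 : gring K G) = 1 by rewrite -counitP /counit ffunE.
exists ((c i)^-1 *: w); split.
- apply: dual_orderZ => //; apply: dual_orderB => //.
  by apply: dual_orderZ; [exact: vJ order_one|exact: dual_order1].
- by rewrite pairingZr pairingBr pairingZr E1 mulr1 subrr mulr0.
- rewrite pairingZr pairingBr pairingZr vf -(counitP f) f1 mulr0 subr0.
  by rewrite mulVf.
Qed.

End HopfOrders.

(** * Lifting primitive elements *)

Section Lifting.
Variables (K : fieldType) (p : nat).
Hypotheses (p_pr : prime p) (charK : p \in [pchar K]).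

Lemma natf_inv k : ~~ (p %| k)%N -> exists l, (k%:R)^-1 = l%:R :> K.
Proof.
move=> pk; have k0 : (0 < k)%N by case: (k) pk; rewrite ?dvdn0.
have [u v uv _] := egcdnP p k0; exists u.
have : coprime k p by rewrite coprime_sym prime_coprime.
rewrite /coprime => /eqP kp; move: uv; rewrite kp => /(congr1 (fun x => x%:R : K)).
rewrite natrD !natrM (pcharf0 charK) mulr0 add0r => uk.
have k0' := natf_coprime_neq0 charK pk.
by apply: (mulIf k0'); rewrite mulVf // uk.
Qed.

Lemma additive_coordf n (i : 'I_n) : additive_fun (coordf K p i).
Proof. by move=> g h; rewrite !ffunE mxE natr_Fp. Qed.

Lemma pairing_coordf_gen n (i j : 'I_n) :
  pairing (coordf K p i) (gelt K (cgen p j) - 1) = (i == j)%:R.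
Proof. by have := coordX p_pr charK i j 1; rewrite expr1 eqxx eq_sym => ->. Qed.

Lemma pairing_counit_gen n (j : 'I_n) :
  pairing (1 : gdual K _) (gelt K (cgen p j) - 1) = 0.
Proof. by have := pairing1X K p j 1; rewrite expr1 => ->. Qed.

Section Hyperplane.
Variables (n : nat) (m : 'I_n).
Implicit Types (f : gdual K (Cp p n)) (u z : gring K (Cp p n)).

Definition hyper_support u := forall g : Cp p n, g 0 m != 0 -> u g = 0.

Lemma hyper_support_prod (s : seq 'I_n) : m \notin s ->
  hyper_support (\prod_(i <- s) (gelt K (cgen p i) - 1)).
Proof.
have supp1 : hyper_support 1.
  move=> g gm; rewrite ffunE; case: eqP => // g1.
  by move: gm; rewrite g1 mxE eqxx.
elim: s => [|i s IH]; first by rewrite big_nil.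
rewrite inE negb_or big_cons => /andP[mi /IH {}IH] g gm.
rewrite gmulE big1 // => h _; have [hm|hm] := eqVneq (h 0 m) 0.
  rewrite [X in _ * X]IH ?mulr0 //.
  by rewrite -[(_ * _)%g]/(- h + g) !mxE hm oppr0 add0r.
rewrite !ffunE; case: eqP => [hi|_].
  by move: hm; rewrite hi mxE (negPf mi) andbF eqxx.
case: eqP => [hi|_]; first by move: hm; rewrite hi mxE eqxx.
by rewrite subrr mul0r.
Qed.

(** Since [z] is transversal to the hyperplane subgroup, the monomials in [z] and
    the [gelt K (cgen p j) - 1] for [j != m] span the group ring: those that
    contain [z] are excluded by one assumption on [f], the others, which are
    supported on the hyperplane, by the other one. *)
Lemma hyperplane_separate z f :
  pairing 1 z = 0 -> pairing (coordf K p m) z != 0 ->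
  (forall u, pairing f (z * u) = 0) ->
  (forall g : Cp p n, g 0 m = 0 -> f g = 0) -> f = 0.
Proof.
set c := pairing (coordf K p m) z => z1 c0 fz fH.
pose X (i : 'I_n) : gdual K (Cp p n) := if i == m then c^-1 *: coordf K p m
  else coordf K p i - (pairing (coordf K p i) z / c) *: coordf K p m.
pose Z (i : 'I_n) : gring K (Cp p n) :=
  if i == m then z else gelt K (cgen p i) - 1.
have XZ : dual_system X Z.
  split=> [i|j|i j]; rewrite /X /Z.
  - case: ifP => _; first exact/additive_funZ/additive_coordf.
    apply: additive_funB; [|apply: additive_funZ]; exact: additive_coordf.
  - by case: ifP => // _; rewrite pairing_counit_gen.
  - have [->|im] := eqVneq i m; have [jm|jm] := eqVneq j m.
    + by rewrite pairingZl mulVf.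
    + by rewrite pairingZl pairing_coordf_gen eq_sym (negPf jm) mulr0.
    + by rewrite pairingBl pairingZl divfK // subrr jm (negPf im).
    + by rewrite pairingBl pairingZl !pairing_coordf_gen [m == j]eq_sym
        (negPf jm) mulr0 subr0.
apply: (monomials_separate XZ p_pr charK); first by rewrite card_ord.
move=> a; rewrite /zmono; have [ma|ma] := boolP (m \in expo_seq a).
  by rewrite (big_rem m ma) /= {1}/Z eqxx fz.
have -> : \prod_(i <- expo_seq a) Z i =
    \prod_(i <- expo_seq a) (gelt K (cgen p i) - 1).
  apply: eq_big_seq => i ia; rewrite /Z; case: eqP => // im.
  by rewrite -im ia in ma.
rewrite /pairing big1 // => g _; have [gm|gm] := eqVneq (g 0 m) 0.
  by rewrite fH // mul0r.
by rewrite hyper_support_prod // mulr0.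
Qed.

Lemma pairing_dual_powers (t : gdual K (Cp p n)) z :
  additive_fun t -> pairing 1 z = 0 -> pairing t z = 1 ->
  exists2 k, ~~ (p %| k)%N & pairing (t ^+ p.-1) (z ^+ p.-1) = k%:R.
Proof.
move=> tD z1 tz; exists (mult_fact (nseq p.-1 tt)).
  apply: mult_fact_neq0 => // -[]; rewrite count_nseq /= mul1n.
  by rewrite prednK ?prime_gt0.
have XZ : dual_system (fun _ : unit => t) (fun _ => z) by split=> // -[] [].
have := pairing_monomial XZ (erefl (size (nseq p.-1 tt))).
by rewrite perm_refl !big_nseq -!Monoid.iteropE.
Qed.

Variables (nu : K -> \bar int) (pi : K).
Hypotheses (nu_val : discrete_valuation nu) (nu_pi : nu pi = 1%:E).
Notation R := (valring nu).
Variable (J : set (gdual K (Cp p n))).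
Hypothesis J_order : hopf_order R J.

Lemma valring_natV k : ~~ (p %| k)%N -> R (k%:R)^-1.
Proof. by case/natf_inv => l ->; exact: valring_nat. Qed.

(** Primitive elements lift.  The idea is that
    [z ^+ p = 0] makes setting [z] to zero an algebra retraction of the dual
    order onto its part supported on the hyperplane, and that primitive
    elements are the derivations at the augmentation.  Concretely,
    multiplication by [z ^+ p.-1] isolates the constant coefficient in the
    expansion in powers of [z], and applying the derivation [hmul t] [p.-1]
    times turns [z ^+ p.-1] into the unit [w] of the dual order; transposing
    this gives an operator on [J] that replaces [u] by [x]. *)
Lemma primitive_lift (c : K) (t u x : gdual K (Cp p n)) z :
  t = c *: coordf K p m -> J t ->
  dual_order nu J z -> pairing 1 z = 0 -> pairing t z = 1 ->
  J u -> additive_fun x -> pairing x z = 0 ->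
  (forall g : Cp p n, g 0 m = 0 -> x g = u g) -> J x.
Proof.
move=> tE Jt Jz z1 tz Ju xD xz xu.
have tD : additive_fun t by rewrite tE; exact/additive_funZ/additive_coordf.
have [k pk kE] := pairing_dual_powers tD z1 tz.
pose w := hmul (t ^+ p.-1) (z ^+ p.-1).
have Jw : dual_order nu J w.
  apply: (dual_order_hmul J_order); first exact: (orderX J_order).
  exact: (dual_orderX nu_val nu_pi J_order).
have w1 : pairing 1 w = k%:R by rewrite pairing_hmul mul1r.
have k0 : k%:R != 0 :> K by exact: (natf_coprime_neq0 charK).
pose f := transl (z ^+ p.-1) (t ^+ p.-1 * transl (w ^+ p.-1) u).
have Jf : J f.
  apply: (order_transl nu_val J_order).
    exact: (dual_orderX nu_val nu_pi J_order).
  apply: (orderM J_order); first exact: (orderX J_order).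
  apply: (order_transl nu_val J_order) => //.
  exact: (dual_orderX nu_val nu_pi J_order).
have predpK : (p.-1.+1 = p)%N by rewrite prednK // prime_gt0.
have tg (g h : Cp p n) : g 0 m = 0 -> t (g * h)%g = t h.
  by move=> gm; rewrite tD [t g](_ : _ = 0) ?add0r // tE !ffunE gm; exact: mulr0.
have fH (g : Cp p n) : g 0 m = 0 -> f g = k%:R ^+ p * u g.
  move=> gm; rewrite -(pairing_gelt f) pairing_transl mulrC.
  rewrite -pairing_hmul pairing_transl.
  have -> : hmul (t ^+ p.-1) (gelt K g * z ^+ p.-1) = gelt K g * w.
    apply/ffunP => h; rewrite ffunE !gmulE.
    rewrite big_distrr /=; apply: eq_bigr => h' _; rewrite !ffunE.
    have [->|_] := eqVneq h' g; last by rewrite !mul0r mulr0.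
    have -> : (t ^+ p.-1) h = (t ^+ p.-1) (g^-1 * h)%g.
      by rewrite !dexpE -{1}(mulKVg g h) tg.
    by rewrite !mul1r.
  rewrite -mulrA -exprS predpK gring_frobenius // w1 -gscaleAr mulr1.
  by rewrite pairingZr pairing_gelt.
have fz v : pairing f (z * v) = 0.
  rewrite pairing_transl mulrAC -exprS predpK gring_frobenius // z1 expr0n.
  by rewrite (gtn_eqF (prime_gt0 p_pr)) scale0r mul0r pairing0r.
clearbody f; suff -> : x = (k%:R ^-1) ^+ p *: f.
  apply: (orderZ nu_val J_order) => //; apply: (valringX nu_val).
  exact: valring_natV.
apply/eqP; rewrite -subr_eq0; apply/eqP; apply: (@hyperplane_separate z) => //.
- apply: contra_eq_neq tz => cz; rewrite tE pairingZl cz mulr0.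
  by rewrite eq_sym oner_eq0.
- by move=> v; rewrite pairingBl pairingZl additive_kills_sq // fz mulr0 subrr.
- move=> g gm; rewrite !ffunE fH // xu //; rewrite exprVn.
  apply/eqP; rewrite subr_eq0; apply/eqP.
  by rewrite -[RHS]/(_ * _) mulKf // expf_neq0.
Qed.

(** The coefficients of an element of [J] as a polynomial in the [X i] are
    determined over [R] by its pairings with monomials in the [Z i], and those
    are integral because the dual order is a ring. *)
Lemma order_generated (I : finType) (X : I -> gdual K (Cp p n))
    (Z : I -> gring K (Cp p n)) (A : set (gdual K (Cp p n))) :
  #|I| = n -> dual_system X Z -> (forall i, J (X i)) ->
  (forall i, dual_order nu J (Z i)) ->
  subalgebra R A -> (forall i, A (X i)) -> J `<=` A.
Proof.
move=> cardI XZ JX JZ [A1 AZD AM] AX f Jf.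
have JXm b : J (xmono X b) by exact: (order_prod J_order).
have JZm a : dual_order nu J (zmono Z a).
  apply: big_ind => //; first exact: (dual_order1 nu_val nu_pi J_order).
  by move=> u v; exact: (dual_orderM nu_val J_order).
have [c fE] := monomial_span XZ p_pr charK cardI f.
have Rc b : R (c b).
  move: b; refine (monomial_coefs XZ p_pr (S := R) _ _ _ _ _).
  - exact: (valring0 nu_val).
  - by move=> x y; exact: (valringB nu_val).
  - move=> x k pk Rx; rewrite -(mulfK (natf_coprime_neq0 charK pk) x).
    by apply: (valringM nu_val) => //; exact: valring_natV.
  - move=> x a b Rx; apply: (valringM nu_val) => //; exact: JZm.
  - by move=> a; rewrite -fE; exact: JZm.
have A0 : A 0.
  by rewrite -(addNr 1) -scaleN1r; apply: AZD => //; exact: (valringN1 nu_val).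
rewrite fE; elim/big_rec: _ => // b y _ Ay; apply: AZD => //.
by apply: big_ind.
Qed.

End Hyperplane.
End Lifting.

(** * Characters of elementary abelian groups *)

Section PrimeField.
Variables (K : fieldType) (p : nat).
Hypotheses (p_pr : prime p) (charK : p \in [pchar K]).

Definition fp_embed (a : 'F_p) : K := (a : nat)%:R.

Lemma fp_embed_val k : fp_embed (k%:R) = k%:R.
Proof.
rewrite /fp_embed val_Fp_nat //.
have /(congr1 (fun q => q%:R : K)) := divn_eq k p.
by rewrite natrD natrM (pcharf0 charK) mulr0 add0r => <-.
Qed.

Lemma fp_embed0 : fp_embed 0 = 0.
Proof. exact: (fp_embed_val 0). Qed.

Lemma fp_embed1 : fp_embed 1 = 1.
Proof. exact: (fp_embed_val 1). Qed.

Lemma fp_embedD a b : fp_embed (a + b) = fp_embed a + fp_embed b.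
Proof. exact: natr_Fp. Qed.

Lemma fp_embedM a b : fp_embed (a * b) = fp_embed a * fp_embed b.
Proof. by rewrite -{1}[a]natr_Zp -{1}[b]natr_Zp -natrM fp_embed_val natrM. Qed.

Lemma fp_embed_sum (I : Type) (r : seq I) (F : I -> 'F_p) :
  fp_embed (\sum_(i <- r) F i) = \sum_(i <- r) fp_embed (F i).
Proof. exact: (big_morph _ fp_embedD fp_embed0). Qed.

Lemma fp_embed_inj : injective fp_embed.
Proof.
suff H a : fp_embed a = 0 -> a = 0.
  move=> a b ab; apply/eqP; rewrite -subr_eq0; apply/eqP/H.
  by apply: (addIr (fp_embed b)); rewrite -fp_embedD subrK add0r.
move=> a0; apply: contra_eq (a0) => a_neq0.
have ap : (a < p)%N by rewrite (leq_trans (ltn_ord _)) // Fp_cast.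
apply: (natf_coprime_neq0 charK (k := a)); rewrite gtnNdvd // lt0n.
by apply: contra a_neq0 => /eqP a0'; apply/eqP/val_inj.
Qed.

Lemma fp_embedX a : fp_embed a ^+ p = fp_embed a.
Proof. by rewrite /fp_embed -(pFrobenius_autE charK) pFrobenius_aut_nat. Qed.

(** The polynomial [x ^+ p - x] splits over the prime field. *)
Lemma fp_embedP x : x ^+ p = x -> exists a, x = fp_embed a.
Proof.
move=> xp; apply: contrapT => xN.
pose P : {poly K} := 'X^p - 'X.
have sP : size P = p.+1.
  by rewrite size_polyDl size_polyXn // size_polyN size_polyX ltnS prime_gt1.
have P0 : P != 0 by rewrite -size_poly_eq0 sP.
pose s := x :: map fp_embed (enum 'F_p).
have s_roots : all (root P) s.
  apply/allP => y; rewrite inE /root !hornerE => /predU1P[->|/mapP[a _ ->]].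
    by rewrite xp subrr.
  by rewrite fp_embedX subrr.
have s_uniq : uniq s.
  rewrite /= map_inj_uniq ?enum_uniq ?andbT //; last exact: fp_embed_inj.
  by apply/mapP => -[a _ xa]; apply: xN; exists a.
have := max_poly_roots P0 s_roots s_uniq.
by rewrite /= size_map -cardE card_Fp // sP ltnn.
Qed.

Variable n : nat.
Implicit Types (f : gdual K (Cp p n)).

Lemma coordfE i (g : Cp p n) : coordf K p i g = fp_embed (g 0 i).
Proof. by rewrite ffunE. Qed.

Lemma coordfX (i : 'I_n) : coordf K p i ^+ p = coordf K p i.
Proof. by apply/ffunP => g; rewrite dexpE coordfE fp_embedX. Qed.

Lemma coordf_cgen (i j : 'I_n) : coordf K p i (cgen p j) = (i == j)%:R.
Proof.
rewrite coordfE mxE eqxx /= eq_sym.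
by case: (_ == _); rewrite ?fp_embed1 ?fp_embed0.
Qed.

Lemma additive_expand f : additive_fun f ->
  f = \sum_j f (cgen p j) *: coordf K p j.
Proof.
move=> fD.
have f0 : f 0 = 0 by exact: (additive_fun1 fD).
have fM g k : f (g *+ k) = f g *+ k.
  by elim: k => [|k IH]; rewrite ?f0 // !mulrS -IH; exact: (fD g (g *+ k)).
apply/ffunP => g; rewrite {1}(row_sum_delta g) sum_ffunE.
have fD' : {morph f : g h / g + h} by exact: fD.
rewrite (big_morph f fD' f0); apply: eq_bigr => j _.
rewrite ffunE coordfE /fp_embed -[in LHS](natr_Zp (g 0 j)) scaler_nat fM.
by rewrite -[RHS]/(_ * _) mulr_natr.
Qed.

Lemma additive_transpose m (M : 'M['F_p]_(m, n)) f : additive_fun f ->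
  additive_fun (transpose (mulmxr M : Cp p m -> Cp p n) f).
Proof.
by move=> fD g h; rewrite !ffunE /= -fD; congr (f _); exact: (mulmxDl g h M).
Qed.

(** A Hopf algebra automorphism permutes the primitive elements fixed by
    Frobenius, which form the [F_p]-space of characters of the group; so on
    primitive elements it is induced by a linear automorphism of the group. *)
Lemma hopf_automorphism_linear (c : gdual K (Cp p n) -> gdual K (Cp p n)) :
  hopf_iso [set: K] [set: _] [set: _] c ->
  exists2 A : 'M['F_p]_n, A \in unitmx
    & forall f, additive_fun f -> c f = transpose (mulmxr A : Cp p n -> Cp p n) f.
Proof.
case=> -[_ [cZD [c1 cM] _ _ cD]] [_ cinj _].
have cZ r f1 f2 : c (r *: f1 + f2) = r *: c f1 + c f2 by exact: cZD.
have c0 : c 0 = 0 by have := cZ (-1) 1 1; rewrite !scaleN1r !addNr.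
have csum (I : Type) (r : seq I) (a : I -> K) (F : I -> gdual K (Cp p n)) :
    c (\sum_(i <- r) a i *: F i) = \sum_(i <- r) a i *: c (F i).
  by elim/big_rec2: _ => // i f1 f2 _ <-; rewrite cZ.
have cX f k : c (f ^+ k) = c f ^+ k.
  by elim: k => [|k IH] //; rewrite !exprS cM // IH.
have cadd f : additive_fun f -> additive_fun (c f).
  move=> fD g h.
  have := cD f [:: (f, 1); (1, f)] I (fun _ _ => conj I I).
  rewrite !big_cons !big_nil /= !addr0 c1 => E.
  have {}E : comul (c f) = tens (c f) 1 + tens 1 (c f).
    apply: E; apply/ffunP => -[g' h']; rewrite !ffunE /= fD.
    by rewrite mulr1 mul1r.
  have := congr1 (fun F : gdual K _ => F (g, h)) E.
  by rewrite !ffunE /= mulr1 mul1r.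
have /choice[A0 A0E] (ij : 'I_n * 'I_n) : exists a,
    c (coordf K p ij.2) (cgen p ij.1) = fp_embed a.
  by apply: fp_embedP; rewrite -dexpE -cX coordfX.
pose A := \matrix_(i, j) A0 (i, j).
have AE i : c (coordf K p i) = \sum_j fp_embed (A j i) *: coordf K p j.
  rewrite {1}(additive_expand (cadd _ (additive_coordf p_pr charK i))).
  by apply: eq_bigr => j _; rewrite (A0E (j, i)) mxE.
have AT i : c (coordf K p i) = transpose (mulmxr A : Cp p n -> Cp p n) (coordf K p i).
  rewrite AE; apply/ffunP => g; rewrite sum_ffunE ffunE coordfE mxE fp_embed_sum.
  by apply: eq_bigr => j _; rewrite ffunE coordfE fp_embedM mulrC.
exists A => [|f fD]; last first.
  rewrite (additive_expand fD) csum; apply/ffunP => g.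
  by rewrite ffunE !sum_ffunE; apply: eq_bigr => j _; rewrite AT !ffunE.
rewrite -unitmx_tr -row_free_unit; apply: inj_row_free => v vA.
have : c (\sum_i fp_embed (v 0 i) *: coordf K p i) = c 0.
  rewrite c0 csum; under eq_bigr => i _ do rewrite AE scaler_sumr.
  rewrite exchange_big big1 //= => j _.
  under eq_bigr => i _ do rewrite scalerA.
  rewrite -scaler_suml (_ : \sum_i _ = 0) ?scale0r //.
  transitivity (fp_embed ((v *m A^T) 0 j)); last by rewrite vA mxE fp_embed0.
  rewrite mxE fp_embed_sum; apply: eq_bigr => i _.
  by rewrite [A^T _ _]mxE fp_embedM.
move=> /(cinj _ _ (mem_set I) (mem_set I)) v0.
apply/rowP => j; rewrite mxE; apply: fp_embed_inj; rewrite fp_embed0.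
have := congr1 (fun F : gdual K _ => F (cgen p j)) v0.
rewrite sum_ffunE ffunE => <-; rewrite (bigD1 j) //= big1 ?addr0.
  by rewrite ffunE coordf_cgen eqxx -[RHS]/(_ * _) mulr1.
by move=> i /negPf ij; rewrite ffunE coordf_cgen ij scaler0.
Qed.

End PrimeField.

(** * Generated subalgebras and the order of rank two *)

Section Generated.
Variables (K : fieldType) (R : set K) (G : finGroupType).
Implicit Types (s : seq (gdual K G)) (A : set (gdual K G)).

Lemma subalg_gen_subalgebra s : subalgebra R (subalg_gen R s).
Proof.
split=> [A [[A1 _ _] _] //|r f g Rr hf hg A AP|f g hf hg A AP].
  by case: (AP) => -[_ AZD _] _; apply: AZD => //; [exact: hf|exact: hg].
by case: (AP) => -[_ _ AM] _; apply: AM; [exact: hf|exact: hg].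
Qed.

Lemma subalg_gen_mem s f : f \in s -> subalg_gen R s f.
Proof. by move=> fs A [_]; apply. Qed.

Lemma subalg_gen_min s A :
  subalgebra R A -> (forall f, f \in s -> A f) -> subalg_gen R s `<=` A.
Proof. by move=> hA sA f; apply; split. Qed.

Hypotheses (R1 : R 1) (RD : forall x y, R x -> R y -> R (x + y)).
Hypothesis RN1 : R (-1).
Hypothesis RM : forall x y, R x -> R y -> R (x * y).

Let R0 : R 0. Proof. by rewrite -(addrN 1); exact: RD. Qed.

Lemma subalgebra0 A : subalgebra R A -> A 0.
Proof. by case=> A1 AZD _; rewrite -(addNr 1) -scaleN1r; exact: AZD. Qed.

(** Splitting off the constant term of a polynomial in [x]: it is the counit,
    because [x] lies in the augmentation ideal. *)
Lemma subalg_gen1_augmentation (x f : gdual K G) : counit x = 0 ->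
  subalg_gen R [:: x] f ->
  exists2 h, subalg_gen R [:: x] h & f = counit f *: (1 : gdual K G) + x * h.
Proof.
move=> x1; have [H1 HZD HM] := subalg_gen_subalgebra [:: x].
have Hx : subalg_gen R [:: x] x by apply: subalg_gen_mem; rewrite inE.
have H0 := subalgebra0 (subalg_gen_subalgebra [:: x]).
pose A f := R (counit f) /\
  exists2 h, subalg_gen R [:: x] h & f = counit f *: (1 : gdual K G) + x * h.
suff : subalg_gen R [:: x] `<=` A by move=> /(_ f) h /h[].
apply: subalg_gen_min; first split.
- split; first by rewrite /counit ffunE.
  by exists 0 => //; rewrite mulr0 addr0 /counit ffunE scale1r.
- move=> r f1 f2 Rr [Rf1 [h1 Hh1 E1]] [Rf2 [h2 Hh2 E2]].
  have cE : counit (r *: f1 + f2) = r * counit f1 + counit f2.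
    by rewrite /counit !ffunE.
  split; first by rewrite cE; apply: RD => //; exact: RM.
  exists (r *: h1 + h2); first exact: HZD.
  rewrite cE {1}E1 {1}E2 scalerDr scalerDl scalerA addrACA; congr (_ + _).
  by rewrite mulrDr dscaleAr.
- move=> f1 f2 [Rf1 [h1 Hh1 E1]] [Rf2 [h2 Hh2 E2]].
  have cE : counit (f1 * f2) = counit f1 * counit f2 by rewrite /counit !ffunE.
  split; first by rewrite cE; exact: RM.
  exists (counit f1 *: h2 + (counit f2 *: h1 + h1 * (x * h2))).
    by apply: (HZD) => //; apply: (HZD) => //; apply: (HM) => //; exact: HM.
  rewrite cE {1}E1 {1}E2 mulrDl -dscaleAl mul1r scalerDr scalerA -addrA.
  by congr (_ + _); rewrite !mulrDr -!dscaleAr mulr1 !mulrA.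
- move=> f1; rewrite inE => /eqP ->; split; first by rewrite x1.
  by exists 1; rewrite ?x1 ?scale0r ?add0r ?mulr1.
Qed.

(** An element of [R[x, y]] is a polynomial in [x] modulo [y]; when [x] satisfies
    an equation of degree [k] modulo [y], degree less than [k] suffices. *)
Lemma subalg_gen2_reduce (x y h0 f : gdual K G) r k : (1 < k)%N ->
  R r -> subalg_gen R [:: x; y] h0 -> x ^+ k = r *: x + y * h0 ->
  subalg_gen R [:: x; y] f ->
  exists2 e : nat -> K, forall j, R (e j) &
    exists2 h, subalg_gen R [:: x; y] h &
      f = \sum_(j < k) e j *: x ^+ j + y * h.
Proof.
set H := subalg_gen R [:: x; y] => k1 Rr Hh0 xk.
have HS := subalg_gen_subalgebra [:: x; y]; have [H1 HZD HM] := HS.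
rewrite -/H in H1 HZD HM; have H0 := subalgebra0 HS; rewrite -/H in H0.
have Hx : H x by apply: subalg_gen_mem; rewrite !inE eqxx.
have Hy : H y by apply: subalg_gen_mem; rewrite !inE eqxx orbT.
pose M f := exists2 e : nat -> K, forall j, R (e j) &
    exists2 h, H h & f = \sum_(j < k) e j *: x ^+ j + y * h.
have MZD c f1 f2 : R c -> M f1 -> M f2 -> M (c *: f1 + f2).
  move=> Rc [e1 Re1 [h1 Hh1 ->]] [e2 Re2 [h2 Hh2 ->]].
  exists (fun j => c * e1 j + e2 j) => [j|]; first by apply: RD => //; exact: RM.
  exists (c *: h1 + h2); first exact: HZD.
  rewrite scalerDr scaler_sumr addrACA -big_split /=; congr (_ + _).
    by apply: eq_bigr => j _; rewrite scalerDl scalerA.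
  by rewrite mulrDr dscaleAr.
have My h : H h -> M (y * h).
  move=> Hh; exists (fun=> 0) => //; exists h => //.
  by rewrite big1 ?add0r // => j _; rewrite scale0r.
have M0 : M 0 by rewrite -(mulr0 y); exact: My.
have Mxj j : (j < k)%N -> M (x ^+ j).
  move=> jk; exists (fun l => (l == j)%:R) => [l|]; first by case: eqP.
  exists 0 => //; rewrite mulr0 addr0 (bigD1 (Ordinal jk)) //= eqxx scale1r.
  by rewrite big1 ?addr0 // => l /negPf; rewrite -val_eqE /= => ->; rewrite scale0r.
have Mx : M x by have := Mxj 1%N k1; rewrite expr1.
have M1 : M 1 by have := Mxj 0%N (ltnW k1); rewrite expr0.
have MxM f' : M f' -> M (x * f').
  case=> e Re [h Hh ->]; rewrite mulrDr mulr_sumr; rewrite mulrCA.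
  elim/big_rec: _ => [|j g _ Mg]; first by rewrite add0r; apply: (My); exact: HM.
  rewrite -addrA -dscaleAr -exprS; apply: (MZD) => //.
  have := ltn_ord j; rewrite leq_eqVlt => /predU1P[->|/Mxj //].
  by rewrite xk; apply: (MZD) => //; exact: My.
have MH f' : M f' -> H f'.
  case=> e Re [h Hh ->]; elim/big_rec: _ => [|j g _ Hg].
    by rewrite add0r; exact: HM.
  rewrite -addrA; apply: (HZD) => //; elim: (nat_of_ord j) => [|l IH] //.
  by rewrite exprS; exact: HM.
suff MS : H `<=` M by exact: MS.
apply: subalg_gen_min; first split=> //.
  move=> f1 f2 [e Re [h Hh ->]] Mf2; have Hf2 := MH _ Mf2.
  rewrite mulrDl mulr_suml; elim/big_rec: _ => [|j g _ Mg].
    by rewrite add0r -mulrA; apply: (My); exact: HM.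
  rewrite -addrA -dscaleAl; apply: (MZD) => //.
  by elim: (nat_of_ord j) => [|l IH]; rewrite ?mul1r // exprS -mulrA; exact: MxM.
move=> g; rewrite !inE => /orP[/eqP -> //|/eqP ->].
by rewrite -(mulr1 y); exact: My.
Qed.

End Generated.

Section RankTwo.
Variables (K : fieldType) (p : nat).
Hypotheses (p_pr : prime p) (charK : p \in [pchar K]).
Variables (nu : K -> \bar int) (pi : K).
Hypotheses (nu_val : discrete_valuation nu) (nu_pi : nu pi = 1%:E).
Notation R := (valring nu).
Variables (i1 i2 : nat) (mu : K).
Hypothesis nu_mu : ((i2%:Z - p%:Z * i1%:Z)%:E <= nu (wp p mu))%E.

Let o0 : 'I_2 := @Ordinal 2 0 isT.
Let o1 : 'I_2 := @Ordinal 2 1 isT.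
Definition rank2_gen1 : gdual K (Cp p 2) :=
  pi ^+ i1 *: (coordf K p o0 - mu *: coordf K p o1).
Definition rank2_gen2 : gdual K (Cp p 2) := pi ^+ i2 *: coordf K p o1.

Lemma Hdual2E : Hdual2 p nu pi i1 i2 mu = subalg_gen R [:: rank2_gen1; rank2_gen2].
Proof. by rewrite /Hdual2 !(xiE p_pr charK). Qed.

Lemma pchar_exprB (a b : K) : (a - b) ^+ p = a ^+ p - b ^+ p.
Proof. by rewrite -!(pFrobenius_autE charK) rmorphB. Qed.

Let ppred : (p.-1.+1 = p)%N. Proof. by rewrite prednK // prime_gt0. Qed.

Lemma wp_mu_integral : R ((pi ^+ i1) ^+ p / pi ^+ i2 * wp p mu).
Proof.
rewrite -exprM; apply/(valring_shift nu_val nu_pi); apply: le_trans nu_mu.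
by rewrite lee_fin mulnC PoszM.
Qed.

Lemma rank2_gen1_frobenius : rank2_gen1 ^+ p = (pi ^+ i1) ^+ p.-1 *: rank2_gen1
  + rank2_gen2 * (- ((pi ^+ i1) ^+ p / pi ^+ i2 * wp p mu) *: (1 : gdual K (Cp p 2))).
Proof.
apply/ffunP => g; rewrite dexpE !ffunE /wp.
set a := pi ^+ i1; set b := pi ^+ i2.
have b0 : b != 0 by rewrite expf_neq0 // (pi_neq0 nu_val nu_pi).
rewrite -!/(fp_embed K _); set k0 := fp_embed K _; set k1 := fp_embed K (g 0 o1).
rewrite -[LHS]/((a * (k0 - mu * k1)) ^+ p).
rewrite -[RHS]/(a ^+ p.-1 * (a * (k0 - mu * k1))
  + b * k1 * (- (a ^+ p / b * (mu ^+ p - mu)) * 1)).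
rewrite exprMn pchar_exprB exprMn !fp_embedX //.
have -> : a ^+ p = a * a ^+ p.-1 by rewrite -exprS ppred.
by field.
Qed.

Lemma valring_integral c r s k : R r -> R s -> c ^+ k.+2 = s + r * c -> R c.
Proof.
move=> Rr Rs E; have [c0|c0] := eqVneq c 0; first by rewrite c0; exact: valring0.
have [m Em] := nu_fin nu_val c0; apply: contrapT => cN.
have RV : R c^-1.
  by move: cN; rewrite /valring /= (nuV nu_val Em) Em !lee_fin; lia.
apply: cN; have -> : c = s * c^-1 ^+ k.+1 + r * c^-1 ^+ k.
  apply: (mulIf (expf_neq0 k.+1 c0)); rewrite -exprS E !exprVn !exprS; field.
  by rewrite c0 expf_neq0.
by apply: (valringD nu_val); apply: (valringM nu_val) => //; apply: (valringX nu_val).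
Qed.

Lemma scaled_mu_integral : R (pi ^+ i1 * mu).
Proof.
have p2 : (p.-2.+2 = p)%N by rewrite -[RHS]ppred; case: (p) (prime_gt1 p_pr) => [|[]].
apply: (@valring_integral _ ((pi ^+ i1) ^+ p.-1)
  ((pi ^+ i1) ^+ p / pi ^+ i2 * wp p mu * pi ^+ i2) p.-2).
- exact/(valringX nu_val)/(valring_pi nu_val nu_pi).
- apply: (valringM nu_val); first exact: wp_mu_integral.
  exact: (valring_pi nu_val nu_pi).
have b0 : pi ^+ i2 != 0 by rewrite expf_neq0 // (pi_neq0 nu_val nu_pi).
rewrite p2 exprMn /wp; set a := pi ^+ i1.
have -> : a ^+ p = a * a ^+ p.-1 by rewrite -exprS ppred.
by field.
Qed.

(** The two generators stay independent modulo [pi] in the cotangent space of the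
    order.  Reducing modulo the second generator and restricting to the line where
    it vanishes leaves a polynomial identity of degree less than [p] with [p]
    solutions, which determines [a]; the rest is a relation
    [b *: rank2_gen2 = rank2_gen2 * h] with [h] in the order. *)
Lemma Hdual2_saturated a b :
  Hdual2 p nu pi i1 i2 mu (a *: rank2_gen1 + b *: rank2_gen2) -> R a /\ R b.
Proof.
have b0 k : pi ^+ k != 0 by rewrite expf_neq0 // (pi_neq0 nu_val nu_pi).
have Rpi k : R (pi ^+ k) by exact: (valring_pi nu_val nu_pi).
have RM x y := @valringM _ _ nu_val x y.
have RD x y := @valringD _ _ nu_val x y.
have RX k x := @valringX _ _ nu_val x k.
have Rval g : forall f, Hdual2 p nu pi i1 i2 mu f -> R (f g).
  suff H : Hdual2 p nu pi i1 i2 mu `<=` [set f | R (f g)] by move=> f /H.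
  rewrite Hdual2E; apply: subalg_gen_min; first split=> /=.
  - by rewrite ffunE; exact: valring1.
  - by move=> r f1 f2 Rr R1 R2; rewrite !ffunE; apply: RD => //; exact: RM.
  - by move=> f1 f2 R1 R2; rewrite ffunE; exact: RM.
  - have Rk (k : nat) : R k%:R by exact: (valring_nat nu_val).
    move=> f; rewrite !inE => /orP[] /eqP -> /=; rewrite !ffunE; last exact: RM.
    rewrite -[X in R X]/(_ * (_ - _ * _)) mulrBr mulrA.
    by apply: (valringB nu_val); apply: RM => //; exact: scaled_mu_integral.
have R0 := valring0 nu_val; have R1 := valring1 nu_val.
have RN1 := valringN1 nu_val.
have RHy : subalg_gen R [:: rank2_gen1; rank2_gen2]
    (- ((pi ^+ i1) ^+ p / pi ^+ i2 * wp p mu) *: (1 : gdual K (Cp p 2))).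
  have HS := subalg_gen_subalgebra R [:: rank2_gen1; rank2_gen2]; have [H1 HZD _] := HS.
  have H0 := subalgebra0 RN1 HS.
  rewrite -[_ *: _]addr0; apply: (HZD) => //.
  by apply: (valringN nu_val); exact: wp_mu_integral.
rewrite Hdual2E => abH.
have [e Re [h]] := subalg_gen2_reduce R1 RD RN1 RM (prime_gt1 p_pr)
  (RX p.-1 _ (Rpi i1)) RHy rank2_gen1_frobenius abH.
rewrite -Hdual2E => /Rval Rh E.
pose g (m l : 'F_p) : Cp p 2 := \row_j (if j == o0 then m else l).
have Hxg m l : rank2_gen1 (g m l) = pi ^+ i1 * (fp_embed K m - mu * fp_embed K l).
  by rewrite !ffunE !mxE.
have Hyg m l : rank2_gen2 (g m l) = pi ^+ i2 * fp_embed K l by rewrite !ffunE !mxE.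
have Eg m l : a * rank2_gen1 (g m l) + b * rank2_gen2 (g m l) =
    \sum_(j < p) e j * (rank2_gen1 (g m l)) ^+ j + rank2_gen2 (g m l) * h (g m l).
  have := congr1 (fun f : gdual K _ => f (g m l)) E.
  move: rank2_gen1 rank2_gen2 => x y; rewrite !ffunE sum_ffunE => ->; congr (_ + _).
  by apply: eq_bigr => j _; rewrite ffunE dexpE.
(* On the line where [rank2_gen2] vanishes, [rank2_gen1] takes [p] distinct
   values. *)
have eE j : (j < p)%N -> e j = a *+ (j == 1%N).
  pose P := \poly_(l < p) (e l * (pi ^+ i1) ^+ l) - (a * pi ^+ i1) *: 'X.
  have P0 : P = 0.
    apply: (@roots_geq_poly_eq0 _ P (map (@fp_embed K p) (enum 'F_p))).
    - apply/allP => _ /mapP[m _ ->]; rewrite /root !hornerE horner_poly.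
      have := Eg m 0; rewrite Hxg Hyg fp_embed0 // !mulr0 mul0r subr0 !addr0.
      rewrite mulrA => ->; rewrite subr_eq0; apply/eqP; apply: eq_bigr => l _.
      by rewrite exprMn mulrA.
    - by rewrite map_inj_uniq ?enum_uniq //; exact: (fp_embed_inj p_pr charK).
    - rewrite size_map -cardE card_Fp // (leq_trans (size_polyD _ _)) //.
      rewrite geq_max size_poly size_polyN (leq_trans (size_scale_leq _ _)) //.
      by rewrite size_polyX prime_gt1.
  move=> jp; have := congr1 (fun Q : {poly K} => Q`_j) P0.
  rewrite coef0 coefB coef_poly jp coefZ coefX => /eqP.
  rewrite subr_eq0 => /eqP; case: (j =P 1%N) => [->|_].
    by rewrite expr1 mulr1 => /(mulIf (b0 _)).
  rewrite mulr0 => /eqP; rewrite mulf_eq0 expf_eq0 (negPf (b0 _)) andbF orbF.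
  by move=> /eqP.
have Ra : R a by have := Re 1%N; rewrite eE ?prime_gt1.
split=> //; have := Eg 0 1.
rewrite (bigD1 (Ordinal (prime_gt1 p_pr))) //= eE ?prime_gt1 // expr1.
rewrite big1 ?addr0 => [|j j1]; last first.
  by rewrite eE // (_ : (j == 1%N :> nat) = false) ?mul0r //; exact: negPf.
move=> /addrI; rewrite mulrC => /(mulfI _) bE.
rewrite bE; first exact: Rh.
by rewrite Hyg fp_embed1 // mulr1.
Qed.

End RankTwo.

(** * The structure of an extension *)

Section Transpose.
Variables (K : fieldType) (R : set K) (G G' : finGroupType) (phi : G -> G').
Implicit Types f : gdual K G'.

Lemma transposeZD c f1 f2 :
  transpose phi (c *: f1 + f2) = c *: transpose phi f1 + transpose phi f2.
Proof. by apply/ffunP => g; rewrite !ffunE. Qed.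

Lemma transposeZ c f : transpose phi (c *: f) = c *: transpose phi f.
Proof. by apply/ffunP => g; rewrite !ffunE. Qed.

Lemma transposeB f1 f2 : transpose phi (f1 - f2) = transpose phi f1 - transpose phi f2.
Proof. by apply/ffunP => g; rewrite !ffunE. Qed.

Lemma transposeM f1 f2 : transpose phi (f1 * f2) = transpose phi f1 * transpose phi f2.
Proof. by apply/ffunP => g; rewrite !ffunE. Qed.

Lemma transpose1 : transpose phi (1 : gdual K G') = 1.
Proof. by apply/ffunP => g; rewrite !ffunE. Qed.

Lemma transposeX f k : transpose phi (f ^+ k) = transpose phi f ^+ k.
Proof. by apply/ffunP => g; rewrite ffunE !dexpE ffunE. Qed.

Lemma transpose_subalg_gen s f :
  subalg_gen R s f -> subalg_gen R (map (transpose phi) s) (transpose phi f).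
Proof.
set B := subalg_gen R (map _ _); have [B1 BZD BM] : subalgebra R B.
  exact: subalg_gen_subalgebra.
suff : subalg_gen R s `<=` [set f | B (transpose phi f)] by move=> h /h.
apply: subalg_gen_min; first split=> /= [|r f1 f2 Rr|f1 f2].
- by rewrite transpose1.
- by rewrite transposeZD; exact: BZD.
- by rewrite transposeM; exact: BM.
- by move=> f1 f1s /=; apply: subalg_gen_mem; exact: map_f.
Qed.

Hypothesis phiM : forall g h, phi (g * h)%g = (phi g * phi h)%g.

Lemma transpose_additive f : additive_fun f -> additive_fun (transpose phi f).
Proof. by move=> fD g h; rewrite !ffunE phiM fD. Qed.

Let phi1 : phi 1%g = 1%g.
Proof. by apply: (mulgI (phi 1%g)); rewrite -phiM !mulg1. Qed.

Lemma transpose_hopf_iso (psi : G' -> G) (J : set (gdual K G'))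
    (J' : set (gdual K G)) :
  cancel phi psi -> cancel psi phi -> (forall f, J' (transpose phi f) <-> J f) ->
  hopf_iso R J J' (transpose phi).
Proof.
move=> phiK psiK JJ'; have TK (f : gdual K G) : transpose phi (transpose psi f) = f.
  by apply/ffunP => g; rewrite !ffunE phiK.
have TK' f : transpose psi (transpose phi f) = f.
  by apply/ffunP => g; rewrite !ffunE psiK.
split; last split.
- split=> [f|]; first by move/JJ'.
  split=> [r f1 f2 _ _ _| |f _|f _|f s _ _ E].
  + exact: transposeZD.
  + by split=> [|f1 f2 _ _]; [exact: transpose1|exact: transposeM].
  + by rewrite /counit ffunE phi1.
  + apply/ffunP => g; rewrite !ffunE; congr (f _).
    by apply: (mulgI (phi g)); rewrite -phiM !mulgV phi1.
  + apply/ffunP => -[g h]; rewrite !ffunE /= phiM.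
    have := congr1 (fun F : gdual K _ => F (phi g, phi h)) E.
    rewrite !ffunE /= => ->; rewrite !sum_ffunE; apply: eq_bigr => w _.
    by rewrite !ffunE.
- by move=> f /JJ'.
- by move=> f1 f2 _ _ /(congr1 (transpose psi)); rewrite !TK'.
- by move=> f J'f; exists (transpose psi f); rewrite ?TK //; apply/JJ'; rewrite TK.
Qed.

End Transpose.

Section Extension.
Variables (p : nat) (K : fieldType).
Hypotheses (p_pr : prime p) (charK : p \in [pchar K]).
Variables (nu : K -> \bar int) (pi : K).
Hypotheses (nu_val : discrete_valuation nu) (nu_pi : nu pi = 1%:E).
Notation R := (valring nu).
Variable J : set (gdual K (Cp p 3)).
Hypothesis J_order : hopf_order R J.
Variables (i1 i2 i3 : nat) (mu : K).
Hypothesis nu_mu : ((i2%:Z - p%:Z * i1%:Z)%:E <= nu (wp p mu))%E.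
Variables (i : gdual K (Cp p 1) -> gdual K (Cp p 3)).
Variables (q : gdual K (Cp p 3) -> gdual K (Cp p 2)).
Hypothesis iq_exact : short_exact R
  (Hdual1 p nu pi i3) J (Hdual2 p nu pi i1 i2 mu) i q.
Variables (a : gdual K (Cp p 1) -> gdual K (Cp p 1)).
Variables (c : gdual K (Cp p 2) -> gdual K (Cp p 2)).
Hypothesis c_iso : hopf_iso [set: K] [set: _] [set: _] c.
Hypothesis iE : forall x, Hdual1 p nu pi i3 x -> i x = transpose (@cproj p) (a x).
Hypothesis qE : forall x, J x -> q x = c (transpose (@cincl p) x).
Variables (A1 : 'M['F_p]_1) (A2 : 'M['F_p]_2).
Hypotheses (A1_unit : A1 \in unitmx) (A2_unit : A2 \in unitmx).
Hypothesis aE : forall f, additive_fun f ->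
  a f = transpose (mulmxr A1 : Cp p 1 -> Cp p 1) f.
Hypothesis cE : forall f, additive_fun f ->
  c f = transpose (mulmxr A2 : Cp p 2 -> Cp p 2) f.

Let o0 : 'I_3 := @Ordinal 3 0 isT.
Let o1 : 'I_3 := @Ordinal 3 1 isT.
Let o2 : 'I_3 := @Ordinal 3 2 isT.
Notation xi0 := (coordf K p o0).
Notation xi1 := (coordf K p o1).
Notation xi2 := (coordf K p o2).

Definition blockmul (M2 : 'M['F_p]_2) (M1 : 'M['F_p]_1) (w : Cp p 3) : Cp p 3 :=
  (row_mx (lsubmx (w : Cp p (2 + 1)) *m M2) (rsubmx (w : Cp p (2 + 1)) *m M1)
   : Cp p (2 + 1)).

Lemma blockmulD M2 M1 g h :
  blockmul M2 M1 (g * h)%g = (blockmul M2 M1 g * blockmul M2 M1 h)%g.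
Proof.
rewrite /blockmul -[(g * h)%g]/(g + h) !linearD /= !mulmxDl.
by rewrite -add_row_mx.
Qed.

Lemma blockmulK M2 M1 : M2 \in unitmx -> M1 \in unitmx ->
  cancel (blockmul M2 M1) (blockmul (invmx M2) (invmx M1)).
Proof.
by move=> u2 u1 w; rewrite /blockmul row_mxKl row_mxKr !mulmxK // hsubmxK.
Qed.

(** The linear automorphism of the group that undoes the two automorphisms in
    the description of the generic fibre. *)
Definition theta := blockmul (invmx A2) A1.
Let T := transpose theta : gdual K (Cp p 3) -> gdual K (Cp p 3).

Let res := transpose (@cincl p) : gdual K (Cp p 3) -> gdual K (Cp p 2).

Lemma cinclD (v w : Cp p 2) : cincl (v * w)%g = (cincl v * cincl w)%g.
Proof. by rewrite /cincl -[(v * w)%g]/(v + w) -[0 in LHS]addr0 -add_row_mx. Qed.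

Lemma outer_aut_res_theta f : additive_fun f -> c (res (T f)) = res f.
Proof.
move=> fD; have -> : res (T f) = transpose (mulmxr (invmx A2)) (res f).
  apply/ffunP => v; rewrite !ffunE; congr (f _).
  by rewrite /theta /blockmul /cincl row_mxKl row_mxKr mul0mx.
have rD : additive_fun (res f) by apply: transpose_additive => //; exact: cinclD.
rewrite cE; last by move=> g h; apply: additive_transpose.
by apply/ffunP => v; rewrite !ffunE /= mulmxK.
Qed.

Let S0 : gdual K (Cp p 3) := pi ^+ i3 *: xi2.
Let t := T S0.
Let s0 : gdual K (Cp p 1) := pi ^+ i3 *: coordf K p (@Ordinal 1 0 isT).

Lemma Hdual1E : Hdual1 p nu pi i3 = subalg_gen R [:: s0].
Proof. by rewrite /Hdual1 !(xiE p_pr charK). Qed.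

Lemma blockmul_last M2 M1 w :
  (blockmul M2 M1 w) 0 o2 = M1 0 0 * w 0 o2.
Proof.
have -> : o2 = rshift 2 (0 : 'I_1) by exact: val_inj.
transitivity ((rsubmx (w : Cp p (2 + 1)) *m M1) 0 0); first exact: row_mxEr.
by rewrite mxE big_ord1 mxE mulrC.
Qed.

Lemma sub_embedding_generator : i s0 = t.
Proof.
rewrite iE; last by rewrite Hdual1E; apply: subalg_gen_mem; rewrite inE.
rewrite aE; last by apply: additive_funZ; exact: additive_coordf.
apply/ffunP => w; rewrite !ffunE /theta blockmul_last; congr (_ *: _).
rewrite -!/(fp_embed K _) /cproj /= mxE big_ord1 mxE.
have -> : rshift 2 (0 : 'I_1) = o2 by exact: val_inj.
by rewrite mulrC; congr (fp_embed K (A1 _ _ * _)); exact: val_inj.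
Qed.

Lemma sub_genE : t = (pi ^+ i3 * fp_embed K (A1 0 0)) *: xi2.
Proof.
apply/ffunP => w; rewrite !ffunE -!/(fp_embed K _) /theta blockmul_last.
by rewrite (fp_embedM p_pr charK); exact: mulrA.
Qed.

Lemma sub_gen_coef_neq0 : pi ^+ i3 * fp_embed K (A1 0 0) != 0.
Proof.
rewrite mulf_neq0 //; first by rewrite expf_neq0 // (pi_neq0 nu_val nu_pi).
have := A1_unit; rewrite unitmxE det_mx11 unitfE; apply: contra_neq => A10.
by apply: (fp_embed_inj p_pr charK); rewrite A10 fp_embed0.
Qed.

Lemma sub_gen_in_order : J t.
Proof.
rewrite -sub_embedding_generator; case: iq_exact => -[[+ _] _] _ _ _; apply.
by rewrite Hdual1E; apply: subalg_gen_mem; rewrite inE.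
Qed.

Lemma res_eq0 (f : gdual K (Cp p 3)) :
  (forall g : Cp p 3, g 0 o2 = 0 -> f g = 0) -> res f = 0.
Proof.
move=> h; apply/ffunP => v; rewrite !ffunE h //.
have -> : o2 = rshift 2 (0 : 'I_1) by exact: val_inj.
by transitivity ((0 : Cp p 1) 0 0); [exact: row_mxEr|rewrite mxE].
Qed.

Lemma sub_gen_hyperplane (g : Cp p 3) : g 0 o2 = 0 -> t g = 0.
Proof. by move=> g0; rewrite sub_genE !ffunE g0 scaler0. Qed.

Lemma outer_aut_linear r f1 f2 : c (r *: f1 + f2) = r *: c f1 + c f2.
Proof. by case: c_iso => -[_ [cZD _ _ _ _]] _; exact: cZD. Qed.

Lemma outer_aut0 : c 0 = 0.
Proof. by have := outer_aut_linear (-1) 1 1; rewrite !scaleN1r !addNr. Qed.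

Lemma outer_autZ r f : c (r *: f) = r *: c f.
Proof. by rewrite -[r *: f]addr0 outer_aut_linear outer_aut0 addr0. Qed.

Lemma outer_aut_inj : injective c.
Proof.
by case: c_iso => _ [_ cinj _] f1 f2; apply: cinj; apply: mem_set.
Qed.

(** A multiple of [t] in [J] is killed by [q], so by exactness it is a multiple of
    [t] within [J]; the factor is integral because elements of [J] have integral
    values. *)
Lemma sub_gen_saturated b : J (b *: t) -> R b.
Proof.
move=> Jbt; case: (iq_exact) => -[[iJ [_ [_ iM] _ _ _]] _] _ _ /(_ _ Jbt)[+ _].
case.
  rewrite qE // (_ : transpose _ _ = 0) ?outer_aut0 //.
  by apply: res_eq0 => g g0; rewrite ffunE sub_gen_hyperplane // scaler0.
move=> s [sP E].
have RD x y := @valringD _ _ nu_val x y.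
have RM x y := @valringM _ _ nu_val x y.
have s01 : counit s0 = 0.
  by rewrite /counit !ffunE mxE scaler0.
have Hs0 : Hdual1 p nu pi i3 s0 by rewrite Hdual1E; apply: subalg_gen_mem; rewrite inE.
have [h Jh Eh] : exists2 h, J h & b *: t = t * h.
  rewrite E; elim: s sP {E} => [|u s IH] sP.
    by exists 0; [exact: (order0 nu_val J_order)|rewrite big_nil mulr0].
  have [Ju1 Hu2 u20] : [/\ J u.1, Hdual1 p nu pi i3 u.2 & counit u.2 = 0].
    by apply: sP; rewrite inE eqxx.
  have [h' Jh' E'] := IH (fun v vs => sP v (mem_behead (s := u :: s) vs)).
  have : subalg_gen R [:: s0] u.2 by rewrite -Hdual1E.
  case/(subalg_gen1_augmentation (valring1 nu_val) RD (valringN1 nu_val) RM s01).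
  rewrite -Hdual1E => k Hk; rewrite u20 scale0r add0r => Ek.
  exists (u.1 * i k + h').
    apply: (orderD nu_val J_order) => //; apply: (orderM J_order) => //.
    exact: iJ.
  by rewrite big_cons E' Ek iM // sub_embedding_generator mulrDr mulrCA.
pose g : Cp p 3 := delta_mx 0 o2.
have tg : t g != 0.
  rewrite sub_genE ffunE coordfE mxE !eqxx fp_embed1 //.
  by rewrite -[_ *: _]/(_ * _) mulr1 sub_gen_coef_neq0.
have {Eh} := congr1 (fun f : gdual K _ => f g) Eh.
move: tg; move: {+}t => t' tg; rewrite !ffunE -[_ *: _]/(_ * _) mulrC => /(mulfI tg) ->.
exact: (order_value nu_val nu_pi J_order).
Qed.

Lemma hyperplane_res (f : gdual K (Cp p 3)) (g : Cp p 3) :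
  g 0 o2 = 0 -> f g = res f (lsubmx (g : Cp p (2 + 1))).
Proof.
move=> g0; have rg0 : rsubmx (g : Cp p (2 + 1)) = 0.
  apply/rowP => j; rewrite !mxE -[RHS]g0; congr (g _ _); apply: val_inj => /=.
  by case: j => -[].
rewrite ffunE; congr (f _); rewrite /cincl -rg0.
exact: (esym (hsubmxK (g : Cp p (2 + 1)))).
Qed.

Lemma exists_lift f : additive_fun f -> Hdual2 p nu pi i1 i2 mu (res f) ->
  exists2 u, J u & forall g : Cp p 3, g 0 o2 = 0 -> T f g = u g.
Proof.
move=> fD Hf; case: iq_exact => _ _ qsurj _.
have [u Ju qu] := qsurj _ Hf; exists u => // g g0.
have : res (T f) = res u by apply: outer_aut_inj; rewrite outer_aut_res_theta // -qu qE.
by rewrite !(hyperplane_res _ g0) => ->.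
Qed.

Let X0 : gdual K (Cp p 3) := pi ^+ i1 *: (xi0 - mu *: xi1).
Let Y0 : gdual K (Cp p 3) := pi ^+ i2 *: xi1.

Lemma res_coord (k : 'I_2) (j : 'I_3) : k = j :> nat ->
  res (coordf K p j) = coordf K p k.
Proof.
move=> kj; apply/ffunP => v; rewrite !ffunE; congr (_%:R); congr nat_of_ord.
have -> : j = lshift 1 k by exact: val_inj.
exact: row_mxEl.
Qed.

Lemma res_X0 : res X0 = rank2_gen1 p pi i1 mu.
Proof. rewrite /X0 /res transposeZ transposeB transposeZ -/res.
rewrite (@res_coord (@Ordinal 2 0 isT) o0) // (@res_coord (@Ordinal 2 1 isT) o1) //. Qed.

Lemma res_Y0 : res Y0 = rank2_gen2 p pi i2.
Proof. by rewrite /Y0 /res transposeZ -/res (@res_coord (@Ordinal 2 1 isT) o1). Qed.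

Lemma res_S0 : res S0 = 0.
Proof. by apply: res_eq0 => g g0; rewrite !ffunE g0; exact: mulr0. Qed.

Lemma theta_additive f : additive_fun f -> additive_fun (T f).
Proof. by apply: transpose_additive => g h; exact: blockmulD. Qed.

Lemma additive_X0 : additive_fun X0.
Proof.
apply/additive_funZ/additive_funB; first exact: additive_coordf.
by apply: additive_funZ; exact: additive_coordf.
Qed.

Lemma additive_Y0 : additive_fun Y0.
Proof. by apply: additive_funZ; exact: additive_coordf. Qed.

Lemma additive_S0 : additive_fun S0.
Proof. by apply: additive_funZ; exact: additive_coordf. Qed.

Lemma primitive_in_order f z : additive_fun f ->
  Hdual2 p nu pi i1 i2 mu (res f) ->
  dual_order nu J z -> pairing 1 z = 0 -> pairing t z = 1 ->
  J (T f - pairing (T f) z *: t).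
Proof.
move=> fD Hf Jz z1 tz; have [u Ju Tu] := exists_lift fD Hf.
apply: (primitive_lift p_pr charK nu_val nu_pi J_order sub_genE
  sub_gen_in_order Jz z1 tz Ju).
- apply: additive_funB; first exact: theta_additive.
  exact/additive_funZ/theta_additive/additive_S0.
- by rewrite pairingBl pairingZl tz mulr1 subrr.
- move=> g g0; rewrite -Tu // -[RHS]subr0; have := sub_gen_hyperplane g0.
  by move: (T f) (t) => f1 f2 g20; rewrite !ffunE g20 scaler0.
Qed.

(** Lifts of the two generators of the quotient, together with the generator of
    the subalgebra, stay independent modulo [pi] in the cotangent space of [J]. *)
Lemma generators_saturated f1 f2 a1 a2 a3 :
  additive_fun f1 -> additive_fun f2 ->
  res f1 = rank2_gen1 p pi i1 mu -> res f2 = rank2_gen2 p pi i2 -> J (T f1) -> J (T f2) ->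
  J (a1 *: T f1 + (a2 *: T f2 + a3 *: t)) -> [/\ R a1, R a2 & R a3].
Proof.
move=> f1D f2D r1 r2 J1 J2 Jf.
have [Ra1 Ra2] : R a1 /\ R a2.
  apply: (Hdual2_saturated p_pr charK nu_val nu_pi nu_mu).
  have := qE Jf; rewrite !transposeZD transposeZ !outer_aut_linear.
  rewrite -/res !outer_aut_res_theta //.
  rewrite r1 r2 outer_autZ outer_aut_res_theta ?res_S0; last exact: additive_S0.
  rewrite scaler0 addr0 => <-.
  by case: iq_exact => -[_ [+ _]] _ _ _; apply.
split=> //; apply: sub_gen_saturated.
have -> : a3 *: t = (a1 *: T f1 + (a2 *: T f2 + a3 *: t)) - a1 *: T f1 - a2 *: T f2.
  by rewrite [a1 *: _ + _]addrC addrK [a2 *: _ + _]addrC addrK.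
by do 2?apply: (orderB nu_val J_order) => //; apply: (orderZ nu_val J_order).
Qed.

(** [J] contains the [p]-th powers of the lifted generators.  The last terms of
    the next two identities are therefore multiples of the generator of the
    subalgebra that lie in [J], which gives the two valuation conditions. *)
Lemma lifted_gen2_frobenius beta : (Y0 - (beta * pi ^+ i2 / pi ^+ i3) *: S0) ^+ p =
  (pi ^+ i2) ^+ p.-1 *: (Y0 - (beta * pi ^+ i2 / pi ^+ i3) *: S0)
  - (pi ^+ (i2 * p) / pi ^+ i3 * wp p beta) *: S0.
Proof.
apply/ffunP => g; rewrite dexpE !ffunE /wp -!/(fp_embed K _).
set a' := pi ^+ i2; set b := pi ^+ i3; rewrite exprM -/a'.
have b0 : b != 0 by rewrite expf_neq0 // (pi_neq0 nu_val nu_pi).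
set k1 := fp_embed K (g 0 o1); set k2 := fp_embed K (g 0 o2).
rewrite -[LHS]/((a' * k1 - beta * a' / b * (b * k2)) ^+ p).
rewrite -[RHS]/(a' ^+ p.-1 * (a' * k1 - beta * a' / b * (b * k2))
  - a' ^+ p / b * (beta ^+ p - beta) * (b * k2)).
have -> : a' * k1 - beta * a' / b * (b * k2) = a' * (k1 - beta * k2) by field.
rewrite exprMn (pchar_exprB charK) exprMn !fp_embedX //.
have -> : a' ^+ p = a' * a' ^+ p.-1 by rewrite -exprS prednK ?prime_gt0.
by field.
Qed.

Lemma lifted_gen1_frobenius alpha beta :
  (X0 - (alpha * pi ^+ i1 / pi ^+ i3) *: S0) ^+ p =
  (pi ^+ i1) ^+ p.-1 *: (X0 - (alpha * pi ^+ i1 / pi ^+ i3) *: S0)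
  - ((pi ^+ i1) ^+ p / pi ^+ i2 * wp p mu) *:
      (Y0 - (beta * pi ^+ i2 / pi ^+ i3) *: S0)
  - (pi ^+ (i1 * p) / pi ^+ i3 * (wp p alpha + wp p mu * beta)) *: S0.
Proof.
apply/ffunP => g; rewrite dexpE !ffunE /wp -!/(fp_embed K _).
set d := pi ^+ i1; set a' := pi ^+ i2; set b := pi ^+ i3; rewrite exprM -/d.
have b0 : b != 0 by rewrite expf_neq0 // (pi_neq0 nu_val nu_pi).
have a0 : a' != 0 by rewrite expf_neq0 // (pi_neq0 nu_val nu_pi).
set k0 := fp_embed K (g 0 o0).
set k1 := fp_embed K (g 0 o1); set k2 := fp_embed K (g 0 o2).
rewrite -[LHS]/((d * (k0 - mu * k1) - alpha * d / b * (b * k2)) ^+ p).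
rewrite -[RHS]/(d ^+ p.-1 * (d * (k0 - mu * k1) - alpha * d / b * (b * k2))
  - d ^+ p / a' * (mu ^+ p - mu) * (a' * k1 - beta * a' / b * (b * k2))
  - d ^+ p / b * (alpha ^+ p - alpha + (mu ^+ p - mu) * beta) * (b * k2)).
have -> : d * (k0 - mu * k1) - alpha * d / b * (b * k2) =
  d * (k0 - mu * k1 - alpha * k2) by field.
rewrite exprMn !(pchar_exprB charK) !exprMn !fp_embedX //.
have -> : d ^+ p = d * d ^+ p.-1 by rewrite -exprS prednK ?prime_gt0.
by field; rewrite b0 a0.
Qed.

(** The parameters are dictated by the choice of a form [z] in the dual order that
    takes the value 1 at the generator of the subalgebra: they are the corrections
    that make the two other generators vanish on [z], so that
    [primitive_in_order] applies. *)
Lemma order_structure : exists alpha beta,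
  [/\ ((i3%:Z - p%:Z * i1%:Z)%:E <= nu (wp p alpha + wp p mu * beta)%R)%E,
      ((i3%:Z - p%:Z * i2%:Z)%:E <= nu (wp p beta))%E
    & J = subalg_gen R (map T
        [:: pi ^+ i1 *: (xi0 - mu *: xi1 - alpha *: xi2);
            pi ^+ i2 *: (xi1 - beta *: xi2); pi ^+ i3 *: xi2])].
Proof.
have pi0 k : pi ^+ k != 0 by rewrite expf_neq0 // (pi_neq0 nu_val nu_pi).
have tD : additive_fun t by exact/theta_additive/additive_S0.
have [z [Jz z1 tz]] :=
  dual_order_split nu_val nu_pi J_order sub_gen_in_order (additive_fun1 tD)
    sub_gen_saturated.
have HX : Hdual2 p nu pi i1 i2 mu (res X0).
  by rewrite res_X0 Hdual2E //; apply: subalg_gen_mem; rewrite !inE eqxx.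
have HY : Hdual2 p nu pi i1 i2 mu (res Y0).
  by rewrite res_Y0 Hdual2E //; apply: subalg_gen_mem; rewrite !inE eqxx orbT.
have := primitive_in_order additive_X0 HX Jz z1 tz.
have := primitive_in_order additive_Y0 HY Jz z1 tz.
set ex := pairing (T X0) z; set ey := pairing (T Y0) z => Jy Jx.
pose alpha := ex * pi ^+ i3 / pi ^+ i1; pose beta := ey * pi ^+ i3 / pi ^+ i2.
have exE : ex = alpha * pi ^+ i1 / pi ^+ i3 by rewrite /alpha divfK ?mulfK ?pi0.
have eyE : ey = beta * pi ^+ i2 / pi ^+ i3 by rewrite /beta divfK ?mulfK ?pi0.
pose X := X0 - ex *: S0; pose Y := Y0 - ey *: S0.
have TX : T X = T X0 - ex *: t by rewrite [LHS]transposeB (transposeZ theta ex).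
have TY : T Y = T Y0 - ey *: t by rewrite [LHS]transposeB (transposeZ theta ey).
rewrite -TX -TY in Jx Jy.
have xz : pairing (T X) z = 0 by rewrite TX pairingBl pairingZl tz mulr1 subrr.
have yz : pairing (T Y) z = 0 by rewrite TY pairingBl pairingZl tz mulr1 subrr.
have XD : additive_fun X.
  by apply: additive_funB; [exact: additive_X0|exact/additive_funZ/additive_S0].
have YD : additive_fun Y.
  by apply: additive_funB; [exact: additive_Y0|exact/additive_funZ/additive_S0].
have resX : res X = rank2_gen1 p pi i1 mu.
  by rewrite [LHS]transposeB (transposeZ _ ex) -/res res_S0 scaler0 subr0 -res_X0.
have resY : res Y = rank2_gen2 p pi i2.
  by rewrite [LHS]transposeB (transposeZ _ ey) -/res res_S0 scaler0 subr0 -res_Y0.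
have Rpi k l : R ((pi ^+ k) ^+ l).
  exact/(valringX nu_val)/(valring_pi nu_val nu_pi).
have JB := orderB nu_val J_order; have JZ := orderZ nu_val J_order.
have JX k f := @orderX _ _ _ _ J_order f k.
exists alpha, beta; split.
- rewrite -PoszM mulnC; apply/(valring_shift nu_val nu_pi); apply: sub_gen_saturated.
  have := congr1 T (lifted_gen1_frobenius alpha beta); rewrite -exE -eyE -/X -/Y.
  set r := pi ^+ _ / _ * _; rewrite [LHS]transposeX [RHS]transposeB.
  rewrite (transposeB theta _ (_ *: Y)) (transposeZ theta _ X).
  rewrite (transposeZ theta _ Y) (transposeZ theta _ S0) -/T -/t.
  move=> E; have -> : r *: t = (pi ^+ i1) ^+ p.-1 *: T X
      - ((pi ^+ i1) ^+ p / pi ^+ i2 * wp p mu) *: T Y - T X ^+ p.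
    by rewrite E opprB addrC subrK.
  apply: (JB); last exact: JX.
  by apply: (JB); apply: (JZ) => //; exact: wp_mu_integral.
- rewrite -PoszM mulnC; apply/(valring_shift nu_val nu_pi); apply: sub_gen_saturated.
  have := congr1 T (lifted_gen2_frobenius beta); rewrite -eyE -/Y.
  set r := pi ^+ _ / _ * _; rewrite [LHS]transposeX [RHS]transposeB.
  rewrite (transposeZ theta _ Y) (transposeZ theta _ S0) -/T -/t.
  move=> E; have -> : r *: t = (pi ^+ i2) ^+ p.-1 *: T Y - T Y ^+ p.
    by rewrite E opprB addrC subrK.
  by apply: (JB); [exact: JZ|exact: JX].
have TXE : X = pi ^+ i1 *: (xi0 - mu *: xi1 - alpha *: xi2).
  rewrite /X exE [in RHS]scalerBr; congr (_ - _).
  by rewrite /S0 !scalerA divfK ?pi0 // mulrC.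
have TYE : Y = pi ^+ i2 *: (xi1 - beta *: xi2).
  rewrite /Y eyE [in RHS]scalerBr; congr (_ - _).
  by rewrite /S0 !scalerA divfK ?pi0 // mulrC.
rewrite -TXE -TYE -/S0 /=; set A := subalg_gen _ _.
have [A1' AZD AM] : subalgebra R A by exact: subalg_gen_subalgebra.
have AS : subalgebra R A by split.
have [Ax Ay At] : [/\ A (T X), A (T Y) & A t].
  by split; apply: subalg_gen_mem; rewrite !inE eqxx ?orbT.
apply/seteqP; split; last first.
  apply: subalg_gen_min; first by case: J_order.
  by move=> f; rewrite !inE => /or3P[] /eqP -> //; exact: sub_gen_in_order.
have Tadd := theta_additive.
have sat a1 a2 a3 : J (a1 *: T X + (a2 *: T Y + a3 *: t)) -> [/\ R a1, R a2 & R a3].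
  exact: generators_saturated.
(* Complete [z] to a system dual to primitive generators.  Subtracting multiples
   of [z] and [Z2] keeps the new forms integral and makes them orthogonal to the
   generators treated before; [T X] is replaced by [x'], which vanishes on [Z2]. *)
have [Z2' [JZ2' Z2'1 yZ2']] : exists u,
    [/\ dual_order nu J u, pairing 1 u = 0 & pairing (T Y) u = 1].
  apply: (dual_order_split nu_val nu_pi J_order Jy (additive_fun1 (Tadd _ YD))).
  move=> b Jb; case: (sat 0 b 0) => //.
  by rewrite !scale0r add0r addr0.
pose Z2 := Z2' - pairing t Z2' *: z.
have JZ2 : dual_order nu J Z2.
  apply: (dual_orderB nu_val JZ2'); apply: (dual_orderZ nu_val) => //.
  by apply: JZ2'; exact: sub_gen_in_order.
have Z21 : pairing 1 Z2 = 0 by rewrite pairingBr pairingZr z1 mulr0 Z2'1 subrr.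
have yZ2 : pairing (T Y) Z2 = 1.
  by rewrite pairingBr pairingZr yz mulr0 subr0.
have tZ2 : pairing t Z2 = 0 by rewrite pairingBr pairingZr tz mulr1 subrr.
pose d := pairing (T X) Z2; have Rd : R d by exact: JZ2.
pose x' := T X - d *: T Y.
have Jx' : J x' by apply: (JB) => //; exact: JZ.
have x'D : additive_fun x'.
  by apply: additive_funB; [exact: Tadd|apply: additive_funZ; exact: Tadd].
have [Z1' [JZ1' Z1'1 xZ1']] : exists u,
    [/\ dual_order nu J u, pairing 1 u = 0 & pairing x' u = 1].
  apply: (dual_order_split nu_val nu_pi J_order Jx' (additive_fun1 x'D)).
  move=> b; rewrite scalerBr scalerA => Jb; case: (sat b (- (b * d)) 0) => //.
  by rewrite scale0r addr0 scaleNr.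
pose Z1 := Z1' - pairing t Z1' *: z - pairing (T Y) Z1' *: Z2.
have JZ1 : dual_order nu J Z1.
  apply: (dual_orderB nu_val); first apply: (dual_orderB nu_val JZ1').
    by apply: (dual_orderZ nu_val) => //; apply: JZ1'; exact: sub_gen_in_order.
  by apply: (dual_orderZ nu_val) => //; exact: JZ1'.
have x'Z2 : pairing x' Z2 = 0 by rewrite pairingBl pairingZl yZ2 mulr1 subrr.
have x'z : pairing x' z = 0 by rewrite pairingBl pairingZl yz mulr0 xz subrr.
have Z1E f : pairing f Z1 = pairing f Z1' - pairing t Z1' * pairing f z
    - pairing (T Y) Z1' * pairing f Z2.
  by rewrite [LHS]pairingBr pairingBr !pairingZr.
have x'Z1 : pairing x' Z1 = 1 by rewrite Z1E x'z x'Z2 xZ1' !mulr0 !subr0.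
have yZ1 : pairing (T Y) Z1 = 0 by rewrite Z1E yz yZ2 mulr0 subr0 mulr1 subrr.
have tZ1 : pairing t Z1 = 0 by rewrite Z1E tz tZ2 mulr0 subr0 mulr1 subrr.
have Z11 : pairing 1 Z1 = 0 by rewrite Z1E z1 Z21 Z1'1 !mulr0 !subr0.
pose Xs (k : 'I_3) := nth 0 [:: x'; T Y; t] k.
pose Zs (k : 'I_3) := nth 0 [:: Z1; Z2; z] k.
have allI3 (P : 'I_3 -> Prop) : P o0 -> P o1 -> P o2 -> forall k, P k.
  by move=> P0 P1 P2 [[|[|[|k]]] // lt_k];
    [move: P0|move: P1|move: P2]; congr P; exact: val_inj.
have XZ : dual_system Xs Zs.
  split.
  - by apply: (allI3); rewrite /Xs //=; exact: Tadd.
  - by apply: (allI3); rewrite /Zs.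
  - apply: (allI3); apply: (allI3); rewrite /Xs /Zs //=.
apply: (order_generated p_pr charK nu_val nu_pi J_order (card_ord 3) XZ _ _ AS).
- by apply: (allI3); rewrite /Xs //=; exact: sub_gen_in_order.
- by apply: (allI3).
- apply: (allI3); rewrite /Xs //= /x' addrC -scaleNr; apply: (AZD) => //.
  exact: (valringN nu_val).
Qed.

End Extension.

Theorem proposition4p4 (p : nat) (p_prime : prime p)
    (K : fieldType) (charK : p \in [pchar K])
    (nu : K -> \bar int) (nu_val : discrete_valuation nu)
    (nu_complete : valuation_complete nu)
    (pi : K) (nu_pi : nu pi = 1%:E)
    (J : set (gdual K (Cp p 3))) (J_order : hopf_order (valring nu) J)
    (i1 i2 i3 : nat) (mu : K)
    (nu_mu : ((i2%:Z - p%:Z * i1%:Z)%:E <= nu (wp p mu))%E)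
    (i : gdual K (Cp p 1) -> gdual K (Cp p 3))
    (q : gdual K (Cp p 3) -> gdual K (Cp p 2))
    (iq_exact : short_exact (valring nu)
       (Hdual1 p nu pi i3) J (Hdual2 p nu pi i1 i2 mu) i q)
    (iq_induced : generic_fibre_dual (Hdual1 p nu pi i3) J i q) :
  exists C : set (K * K), is_coset (param_subgroup p nu i1 i2 i3 mu) C /\
  exists alpha beta : K,
    [/\ C (alpha, beta),
        ((i3%:Z - p%:Z * i1%:Z)%:E <= nu (wp p alpha + wp p mu * beta)%R)%E,
        ((i3%:Z - p%:Z * i2%:Z)%:E <= nu (wp p beta))%E
      & hopf_isomorphic (valring nu) J
          (Hdual3 p nu pi i1 i2 i3 mu alpha beta)].
Proof.
case: iq_induced => a [c [a_iso c_iso iE qE]].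
have [A1 A1_unit aE] := hopf_automorphism_linear p_prime charK a_iso.
have [A2 A2_unit cE] := hopf_automorphism_linear p_prime charK c_iso.
have [alpha [beta [nu_alpha nu_beta JE]]] := order_structure p_prime charK
  nu_val nu_pi J_order nu_mu iq_exact c_iso iE qE A1_unit A2_unit aE cE.
pose th := theta A1 A2; pose ps := blockmul A2 (invmx A1).
have thK : cancel th ps.
  by have := @blockmulK p (invmx A2) A1; rewrite unitmx_inv invmxK; apply.
have psK : cancel ps th.
  by have := @blockmulK p A2 (invmx A1); rewrite unitmx_inv invmxK; apply.
exists [set (alpha, beta) + l | l in param_subgroup p nu i1 i2 i3 mu].
split; first by exists (alpha, beta).
exists alpha, beta; split=> //.
  exists 0; rewrite ?addr0 //; exists (0, 0).
    exists 0; first by exists 0.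
    by rewrite mul0r oppr0.
  exists (0, 0); last by rewrite addr0.
  split; rewrite /fracideal /= ?(nu0 nu_val) ?leey //.
  exists 0; first by exists 0.
  by exists 0; rewrite ?addr0 //= (nu0 nu_val) leey.
have Tps (f : gdual K (Cp p 3)) : transpose ps (transpose th f) = f.
  by apply/ffunP => g; rewrite !ffunE psK.
have JE' f : J (transpose th f) <-> Hdual3 p nu pi i1 i2 i3 mu alpha beta f.
  rewrite /Hdual3 !(xiE p_prime charK) JE; split; last first.
    exact: transpose_subalg_gen.
  move=> /(transpose_subalg_gen (phi := ps)); rewrite -map_comp Tps.
  by rewrite map_id_in // => g _; exact: Tps.
exists (transpose ps); apply: (transpose_hopf_iso _ _ psK thK) => [g h|f].
  exact: blockmulD.
rewrite -JE'; suff -> : transpose th (transpose ps f) = f by [].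
by apply/ffunP => g; rewrite !ffunE thK.
Qed.
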